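(* Let $N,M\in\mathbb N$, let $(\mu^{(k)},\nu^{(k)})\in\Delta_N\times\Delta_M$, $\pi^{(k)}\in\Pi(\mu^{(k)},\nu^{(k)})$ and $\alpha^{(k)}\in\mathbb R$, $k=1,2,\dots$, and assume that there exists $c\in\mathbb R^{N\times M}$ with $\alpha^{(k)}=\mathcal T_c(\mu^{(k)},\nu^{(k)})=\langle c,\pi^{(k)}\rangle$ for all $k$. Suppose that for $K=1,2,\dots$ we observe $$y^{(k)}=\alpha^{(k)}+\varepsilon^{(k)}=\langle c,\pi^{(k)}\rangle+\varepsilon^{(k)},\qquad k\in\{1,\dots,K\},$$ where $(\varepsilon^{(k)})_{k\ge1}$ is a sequence of independent centered real random variables with common variance $\sigma^2>0$. Suppose that there exists a positive definite matrix $Q\in\mathbb R^{NM\times NM}$ such that $$\frac1K P_K^{\top}P_K\to Q\qquad\text{as }K\to\infty.$$ Then the least squares estimator $\hat c_K\in\arg\min_{c'\in\mathbb R^{N\times M}}\|\boldsymbol Y_K-P_K\boldsymbol c'\|_2^2$ is strongly consistent, i.e. $\hat{\boldsymbol c}_K\to\boldsymbol c$ almost surely as $K\to\infty$. If additionally there is $\delta>0$ such that the $(2+\delta)$-th moment of $\varepsilon^{(k)}$ exists and is uniformly bounded over all $k=1,2,\dots$, then $$\sqrt K(\hat{\boldsymbol c}_K-\boldsymbol c)\to\mathcal N(\boldsymbol 0,\sigma^2Q^{-1})\quad\text{in distribution as }K\to\infty,$$ where $\mathcal N(\boldsymbol 0,\Sigma)$ denotes the $NM$-dimensional centered normal distribution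 with covariance matrix $\Sigma$.
   Context: $\Delta_N=\{x\in\mathbb R^N: x_i\ge 0,\ \sum_i x_i=1\}$. $\Pi(\mu,\nu)$ is the set of $N\times M$ matrices with nonnegative entries, row sums $\mu$ and column sums $\nu$; $\mathcal T_c(\mu,\nu)=\min_{\pi\in\Pi(\mu,\nu)}\langle c,\pi\rangle$ with the Frobenius inner product. Bold symbols denote column-major vectorization: $\boldsymbol c\in\mathbb R^{NM}$ is the vectorization of $c\in\mathbb R^{N\times M}$, and similarly $\boldsymbol\pi^{(k)}$, $\hat{\boldsymbol c}_K$. $P_K=[\boldsymbol\pi^{(1)}\ \cdots\ \boldsymbol\pi^{(K)}]^\top\in\mathbb R^{K\times NM}$ and $\boldsymbol Y_K=(y^{(1)},\dots,y^{(K)})^\top$. The plans $\pi^{(k)}$ are fixed (non-random); only the noise is random. *)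

(* Defs.v *)
From HB Require Import structures.
From mathcomp Require Import all_boot all_order all_algebra finmap.
From mathcomp Require Import all_classical all_reals all_analysis.

Set Implicit Arguments.
Unset Strict Implicit.
Unset Printing Implicit Defensive.

Import Order.TTheory GRing.Theory Num.Theory.
Import numFieldNormedType.Exports.

Local Open Scope classical_set_scope.
Local Open Scope ring_scope.

(* mxvec is row-major, hence the transposition: entry (i, j) of A sits at
   position j * N + i of vec A. *)
Definition vec (R : realType) (N M : nat) (A : 'M[R]_(N, M)) : 'cV[R]_(M * N) :=
  (mxvec A^T)^T.

Definition frobenius (R : realType) (N M : nat) (A B : 'M[R]_(N, M)) : R :=
  \sum_i \sum_j A i j * B i j.

(* The norm `|x| that the library puts on matrices is the sup norm. *)
Definition sqnorm2 (R : realType) (n : nat) (x : 'cV[R]_n) : R :=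
  \sum_i x i 0 ^+ 2.

Definition posdef (R : realType) (n : nat) (A : 'M[R]_n) : Prop :=
  A^T = A /\ forall x : 'cV[R]_n, x != 0 -> 0 < (x^T *m A *m x) 0 0.

Definition prob_simplex (R : realType) (n : nat) : set 'cV[R]_n :=
  [set x : 'cV[R]_n | (forall i, 0 <= x i 0) /\ \sum_i x i 0 = 1].

Definition transport_plans (R : realType) (N M : nat)
    (mu : 'cV[R]_N) (nu : 'cV[R]_M) : set 'M[R]_(N, M) :=
  [set p : 'M[R]_(N, M) | [/\ forall i j, 0 <= p i j,
               forall i, \sum_j p i j = mu i 0
             & forall j, \sum_i p i j = nu j 0]].

(* For mu and nu in the simplex the set of plans is compact and nonempty, so
   this infimum is a minimum. *)
Definition ot_cost (R : realType) (N M : nat) (c : 'M[R]_(N, M))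
    (mu : 'cV[R]_N) (nu : 'cV[R]_M) : R :=
  inf [set frobenius c p | p in transport_plans mu nu].

(* Sequences are indexed from 0: the first K observations are those of index
   k < K. *)
Definition design (R : realType) (N M : nat) (p : nat -> 'M[R]_(N, M))
    (K : nat) : 'M[R]_(K, M * N) :=
  \matrix_(k, l) vec (p k) l 0.

Definition least_squares (R : realType) (N M : nat) (p : nat -> 'M[R]_(N, M))
    (y : nat -> R) (K : nat) : set 'M[R]_(N, M) :=
  let loss (c : 'M[R]_(N, M)) :=
    sqnorm2 ((\col_(k < K) y k) - design p K *m vec c) in
  [set c : 'M[R]_(N, M) | forall c', loss c <= loss c'].

(* Mutual independence: product rule over every finite subfamily. *)
Definition independent_RVs (d : measure_display) (T : measurableType d)
    (R : realType) (P : probability T R) (X : nat -> {RV P >-> R}) : Prop :=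
  forall (J : {fset nat}) (B : nat -> set R),
    (forall k, measurable (B k)) ->
    P (\bigcap_(k in [set` J]) (X k @^-1` B k)) =
    (\prod_(k <- J) P (X k @^-1` B k))%E.

Notation borel T := (g_sigma_algebraType (@open T)).

(* v is the variance, whereas normal_prob takes the standard deviation and is
   not a Dirac mass when the latter is 0. *)
Definition normal1 (R : realType) (m v : R) (B : set R) : \bar R :=
  if v == 0 then \d_m B else normal_prob m (Num.sqrt v) B.

(* mu = N(m, S) on R^n: every linear functional <a, .> has law
   N(<a, m>, <a, S a>) under mu. *)
Definition is_multinormal (R : realType) (n : nat) (m : 'cV[R]_n) (S : 'M[R]_n)
    (mu : probability (borel 'cV[R]_n) R) : Prop :=
  forall (a : 'cV[R]_n) (B : set R), measurable B ->
    mu [set x : 'cV[R]_n | B ((a^T *m x) 0 0)] =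
    normal1 ((a^T *m m) 0 0) ((a^T *m S *m a) 0 0) B.

(* Convergence in distribution of X K to mu, tested against bounded continuous
   functions.  The X K are only required to be random vectors for large K: a
   least squares estimator is unique, hence measurable, only once the design
   matrix has full column rank. *)
Definition cvg_in_distribution (d : measure_display) (T : measurableType d)
    (R : realType) (P : probability T R) (n : nat)
    (X : nat -> T -> 'cV[R]_n) (mu : probability (borel 'cV[R]_n) R) : Prop :=
  (\forall K \near \oo, measurable_fun setT (X K : T -> borel 'cV[R]_n)) /\
  forall f : 'cV[R]_n -> R, continuous f ->
    (exists b : R, forall x, `|f x| <= b) ->
    ('E_P[f \o X K] @[K --> \oo] --> \int[mu]_x (f x)%:E)%E.

(* Main.v *)
Require Import Defs.
From HB Require Import structures.
From mathcomp Require Import all_boot all_order all_algebra finmap.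
From mathcomp Require Import all_classical all_reals all_analysis.
From mathcomp Require Import measurable_realfun ring lra.

(** Since frobenius c (p k) is the dot product of vec c with x_k = vec (p k), the
    model is a linear regression y_k = <x_k, c> + eps_k with fixed regressors, whose
    entries lie in [0, 1] because plans between probability vectors are bounded by
    their marginals.  The normal equations give, for the Gram matrix
    G_K = (1 / K) P_K^T P_K,

      G_K (vec chat - vec c) = (1 / K) (eps_0 x_0 + ... + eps_(K-1) x_(K-1)),

    and G_K tends to the invertible matrix Q, so that G_K^-1 tends to Q^-1
    ([cvg_invmx]).

    Consistency.  The right-hand side tends to 0 almost surely, coordinate by
    coordinate.  Its summands are uncorrelated with bounded second moments, for which
    a strong law holds by Rajchman's argument along the squares
    ([slln_uncorrelated]).

    Asymptotic normality.  For large K the vector sqrt K (vec chat - vec c) is the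
    sum of the eps_k u_(K, k) with u_(K, k) = K^(-1/2) G_K^-1 x_k.  For a fixed vector a
    the weights <a, u_(K, k)> are of order K^(-1/2) and the sum of their squares is
    a^T G_K^-1 a, which tends to a^T Q^-1 a.  The moment condition makes the squares
    of the eps_k uniformly integrable, so a Lindeberg argument on characteristic
    functions shows that <a, sqrt K (vec chat - vec c)> has the characteristic
    function of N(0, sigma^2 a^T Q^-1 a) in the limit ([cvg_charfun_triangular]).

    The passage from linear functionals to convergence in distribution on R^n is
    Levy's theorem ([levy_continuity]): second moments give tightness, and bounded
    continuous functions are approximated on boxes by trigonometric polynomials
    ([trigpoly_approx]).  The limit law is built by hand: sigma^2 Q^-1 is a sum of
    rank-one squares b b^T ([psd_sum_of_squares]), so the law of the sum of the xi_b b
    with independent standard normal xi_b has the right characteristic function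
    ([gaussian_vector_exists]), and the laws of its linear functionals
    are normal because characteristic functions determine laws on the line
    ([charfun_unique]). *)

Set Implicit Arguments.
Unset Strict Implicit.
Unset Printing Implicit Defensive.

Import Order.TTheory GRing.Theory Num.Theory.
Import numFieldNormedType.Exports.

Local Open Scope classical_set_scope.
Local Open Scope ring_scope.

(** * Independent pairs and partial sums *)

Definition independent_pair d (T : measurableType d) (R : realType)
    (P : probability T R) (X Y : T -> R) : Prop :=
  forall A B : set R, measurable A -> measurable B ->
    P (X @^-1` A `&` Y @^-1` B) = (P (X @^-1` A) * P (Y @^-1` B))%E.

Lemma independent_pair_comp d (T : measurableType d) (R : realType)
    (P : probability T R) (X Y : T -> R) (f g : R -> R) :
  measurable_fun setT f -> measurable_fun setT g ->
  independent_pair P X Y -> independent_pair P (f \o X) (g \o Y).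
Proof.
move=> mf mg XY A B mA mB; apply: (XY (f @^-1` A) (g @^-1` B)).
  by rewrite -[X in measurable X]setTI; exact: mf.
by rewrite -[X in measurable X]setTI; exact: mg.
Qed.

(** Independence says that the joint law of X and Y is the product of their laws;
    Fubini then splits the integral of the product function on the plane. *)
Lemma independent_pairM d (T : measurableType d) (R : realType)
    (P : probability T R) (X Y : T -> R) :
  measurable_fun setT X -> measurable_fun setT Y ->
  independent_pair P X Y ->
  P.-integrable setT (EFin \o X) -> P.-integrable setT (EFin \o Y) ->
  P.-integrable setT (EFin \o (X \* Y)) ->
  \int[P]_w (X w * Y w) = \int[P]_w X w * \int[P]_w Y w.
Proof.
move=> mX mY XY iX iY iXY.
pose X' : {mfun T >-> R} := mfun_Sub (mem_set mX).
pose Y' : {mfun T >-> R} := mfun_Sub (mem_set mY).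
have mZ : measurable_fun setT (fun w => (X w, Y w)).
  exact: measurable_fun_pair.
pose Z' : {mfun T >-> (R * R)%type} := mfun_Sub (mem_set mZ).
pose m1 := distribution P X'; pose m2 := distribution P Y'.
pose m := distribution P Z'.
have mE A : measurable A -> (m1 \x m2)%E A = m A.
  apply: product_measure_unique => B C mB mC.
  by rewrite /m /m1 /m2 /distribution /pushforward -XY.
pose f := fun z : (R * R)%type => (z.1 * z.2)%:E.
have mf : measurable_fun setT f.
  by apply/measurable_EFinP; exact: measurable_funM.
have mi : m.-integrable setT f by exact: integrable_pushforward.
have fin1 : m1.-integrable setT (EFin : R -> \bar R).
  by apply: integrable_pushforward => //; exact/measurable_EFinP.
have fin2 : m2.-integrable setT (EFin : R -> \bar R).
  by apply: integrable_pushforward => //; exact/measurable_EFinP.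
have e1 : (\int[P]_w (X w)%:E = \int[m1]_x x%:E)%E.
  by rewrite integral_distribution//; exact/measurable_EFinP.
have e2 : (\int[P]_w (Y w)%:E = \int[m2]_x x%:E)%E.
  by rewrite integral_distribution//; exact/measurable_EFinP.
have e3 : (\int[P]_w (X w * Y w)%:E = \int[m1 \x m2]_z f z)%E.
  transitivity (\int[m]_z f z)%E; first by rewrite integral_distribution.
  by apply: eq_measure_integral => A mA _; exact/esym/mE.
have mi' : (m1 \x m2)%E.-integrable setT f.
  apply/integrableP; split => //.
  rewrite (@eq_measure_integral _ _ _ _ m) => [|A mA _]; last exact: mE.
  by case/integrableP : mi.
rewrite /Rintegral e1 e2 e3 -integral12_prod_meas1//.
set c := (\int[m2]_x x%:E)%E.
have cE : c = (fine c)%:E by rewrite fineK//; exact: integrable_fin_num.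
have -> : fubini_F m2 f = (fun x => x%:E * (fine c)%:E)%E.
  apply/funext => x; by rewrite /fubini_F -cE /c -integralZl.
by rewrite integralZr// fineM//; exact: integrable_fin_num.
Qed.

Lemma independent_RVs_bigsetI d (T : measurableType d) (R : realType)
    (P : probability T R) (X : nat -> {RV P >-> R}) (B : nat -> set R) K :
  independent_RVs X -> (forall k, measurable (B k)) ->
  P (\big[setI/setT]_(k < K) (X k @^-1` B k)) =
  (\prod_(k < K) P (X k @^-1` B k))%E.
Proof.
move=> indX mB; pose J := [fset k in iota 0 K]%fset.
have pJ : perm_eq J (index_iota 0 K).
  apply: uniq_perm => [||k]; [exact: fset_uniq|exact: iota_uniq|].
  by rewrite in_fset /index_iota subn0.
have := indX J B mB.
by rewrite bigcap_fset (perm_big _ pJ) big_mkord (perm_big _ pJ) big_mkord.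
Qed.

Lemma independent_RVs_pair d (T : measurableType d) (R : realType)
    (P : probability T R) (X : nat -> {RV P >-> R}) i j :
  independent_RVs X -> i != j -> independent_pair P (X i) (X j).
Proof.
move=> indX ij A B mA mB.
pose C k := if k == i then A else B.
have mC k : measurable (C k) by rewrite /C; case: ifP.
have := indX [fset i; j]%fset C mC.
rewrite bigcap_fset !big_fsetU1 ?inE//= !big_seq_fset1 /C eqxx.
by rewrite eq_sym (negbTE ij).
Qed.

(** The events of the form X_0 in B_0, ..., X_(K-1) in B_(K-1) form a pi-system
    that generates a sigma-algebra making every partial sum of index below K
    measurable.  On this pi-system the measures E |-> P(E, X_K in C) and
    E |-> P(X_K in C) P(E) agree, hence they agree on the generated
    sigma-algebra. *)
Lemma independent_RVs_sum d (T : measurableType d) (R : realType)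
    (P : probability T R) (X : nat -> {RV P >-> R}) (s : nat -> R) K :
  independent_RVs X ->
  independent_pair P (fun w => \sum_(k < K) s k * X k w) (X K).
Proof.
move=> indX A C mA mC.
pose G := [set E : set T | exists2 B : nat -> set R, forall k, measurable (B k)
  & E = \big[setI/setT]_(k < K) (X k @^-1` B k)].
have mX k B : measurable B -> measurable (X k @^-1` B).
  by move=> mB; rewrite -[_ @^-1` _]setTI; exact: measurable_funP.
have mG : G `<=` measurable.
  by move=> _ [B mB ->]; apply: bigsetI_measurable => k _; exact: mX.
have GI : setI_closed G.
  move=> _ _ [B mB ->] [B' mB' ->]; exists (fun k => B k `&` B' k).
    by move=> k; exact: measurableI.
  by rewrite -big_split.
have GT : G setT.
  by exists (fun=> setT) => //; rewrite big1.
have mE := mX K C mC.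
have PE_ge0 : 0 <= fine (P (X K @^-1` C)) by exact: fine_ge0.
pose m1 := mrestr P mE.
pose m2 := mscale (NngNum PE_ge0) P.
have m2E E : m2 E = (P (X K @^-1` C) * P E)%E.
  rewrite /m2 /mscale (_ : (NngNum PE_ge0)%:num = fine (P (X K @^-1` C)))//.
  by rewrite fineK// fin_num_measure.
have m12 E : <<s G >> E -> m1 E = m2 E.
  apply: (g_sigma_algebra_measure_unique G mG (fun=> setT)) => //.
  - by rewrite bigcup_const//; exists 0%N.
  - move=> _ [B mB ->]; rewrite [RHS]m2E [LHS]/(P (_ `&` _)).
    pose D k := if k == K then C else B k.
    have mD k : measurable (D k) by rewrite /D; case: ifP.
    have := independent_RVs_bigsetI K.+1 indX mD.
    have DB k : (k < K)%N -> D k = B k by rewrite /D => /ltn_eqF ->.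
    rewrite !big_ord_recr/= {2 4}/D eqxx.
    under eq_bigr do rewrite DB//.
    under [in RHS]eq_bigr do rewrite DB//.
    by rewrite -independent_RVs_bigsetI// muleC.
  - by move=> _; rewrite [ltLHS]/(P (_ `&` _)) setTI (le_lt_trans (probability_le1 _ _)) ?ltry.
have mS : measurable_fun setT
    ((fun w => \sum_(k < K) s k * X k w) : g_sigma_algebraType G -> R).
  apply: measurable_sum => k; apply: measurable_funM => //.
  move=> _ B mB; rewrite setTI; apply: sub_sigma_algebra.
  exists (fun j : nat => if j == k :> nat then B else setT).
    by move=> j; case: ifP.
  rewrite (bigD1 k)//= eqxx big1 ?setIT// => j jk.
  by rewrite ifF//; apply/negbTE.
have := m12 _ (mS measurableT A mA).
by rewrite setTI [X in _ = X -> _]m2E muleC.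
Qed.

(** * A strong law of large numbers for uncorrelated variables *)

(** Monotone convergence makes the sum of the series integrable, hence finite
    almost everywhere, and the terms of a convergent series vanish. *)
Lemma ae_cvg0_summable_integrals d (T : measurableType d) (R : realType)
    (mu : {measure set T -> \bar R}) (Z : nat -> T -> R) (M : R) :
  (forall n, measurable_fun setT (Z n)) -> (forall n w, 0 <= Z n w) ->
  (forall n, (\sum_(0 <= i < n) \int[mu]_w (Z i w)%:E <= M%:E)%E) ->
  {ae mu, forall w, Z n w @[n --> \oo] --> (0 : R)}.
Proof.
move=> mZ Z0 ZM.
have mZ' n : measurable_fun setT (EFin \o Z n) by exact/measurable_EFinP.
have Z0' n w : (0 <= (Z n w)%:E)%E by rewrite lee_fin.
pose S w := (\sum_(n <oo) (Z n w)%:E)%E.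
have mS : measurable_fun setT S.
  apply: (@ge0_emeasurable_sum _ _ _ _ (fun n w => (Z n w)%:E) xpredT) => // k _.
  exact: mZ'.
have S0 w : (0 <= S w)%E by exact: nneseries_ge0.
have iS : mu.-integrable setT S.
  apply/integrableP; split => //.
  rewrite (eq_integral S); last by move=> w _; rewrite gee0_abs.
  rewrite integral_nneseries//.
  apply: (@le_lt_trans _ _ M%:E); last by rewrite ltry.
  apply: lime_le; last by apply: nearW.
  by apply: is_cvg_nneseries => n _ _; exact: integral_ge0.
have := integrable_ae measurableT iS; apply: filterS => w /(_ I) Sfin.
apply: cvg_series_cvg_0; apply: nondecreasing_is_cvgn.
  by apply: nondecreasing_series => n _ _.
exists (fine (S w)) => _ [n _ <-].
rewrite -lee_fin fineK// /series/= -sumEFin.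
by apply: nneseries_lim_ge => k _ _.
Qed.

Lemma integrableM_L2 d (T : measurableType d) (R : realType)
    (mu : {measure set T -> \bar R}) (X Y : T -> R) :
  measurable_fun setT X -> measurable_fun setT Y ->
  mu.-integrable setT (fun w => (X w ^+ 2)%:E) ->
  mu.-integrable setT (fun w => (Y w ^+ 2)%:E) ->
  mu.-integrable setT (fun w => (X w * Y w)%:E).
Proof.
move=> mX mY iX iY.
apply: (@le_integrable _ _ _ _ _ _ _ (fun w => (X w ^+ 2)%:E + (Y w ^+ 2)%:E)%E) => //.
- by apply/measurable_EFinP; exact: measurable_funM.
- move=> w _; rewrite /= lee_fin normrM.
  rewrite [leRHS]ger0_norm ?addr_ge0 ?sqr_ge0//.
  rewrite -(real_normK (num_real (X w))) -(real_normK (num_real (Y w))).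
  by have := sqr_ge0 (`|X w| - `|Y w|); have := normr_ge0 (X w);
    have := normr_ge0 (Y w); nra.
- exact: integrableD.
Qed.

Lemma integral_sqr_sum_uncorrelated d (T : measurableType d) (R : realType)
    (mu : {measure set T -> \bar R}) (X : nat -> T -> R) (C : R) m n :
  (forall k, measurable_fun setT (X k)) ->
  (forall k, (\int[mu]_w (X k w ^+ 2)%:E <= C%:E)%E) ->
  (forall i j, i != j -> (\int[mu]_w (X i w * X j w)%:E = 0)%E) ->
  (\int[mu]_w ((\sum_(m <= k < n) X k w) ^+ 2)%:E <= (C * (n - m)%:R)%:E)%E.
Proof.
move=> mX X2 X0.
have iX2 k : mu.-integrable setT (fun w => (X k w ^+ 2)%:E).
  apply/integrableP; split.
    by apply/measurable_EFinP; exact: measurable_funX.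
  rewrite (eq_integral (fun w => (X k w ^+ 2)%:E)).
    by rewrite (le_lt_trans (X2 k))// ltry.
  by move=> w _; rewrite gee0_abs// lee_fin sqr_ge0.
have iXX i j : mu.-integrable setT (fun w => (X i w * X j w)%:E).
  exact: integrableM_L2.
have -> : (fun w => ((\sum_(m <= k < n) X k w) ^+ 2)%:E) =
    (fun w => \sum_(m <= i < n) \sum_(m <= j < n) (X i w * X j w)%:E)%E.
  apply/funext => w; rewrite expr2 mulr_suml -sumEFin.
  by apply: eq_bigr => i _; rewrite mulr_sumr -sumEFin.
rewrite integral_sum//; last first.
  by move=> i; apply: integrable_sum.
have Ei i : (m <= i < n)%N ->
    (\int[mu]_w (\sum_(m <= j < n) (X i w * X j w)%:E) <= C%:E)%E.
  move=> imn; rewrite integral_sum//.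
  rewrite (bigD1_seq i)/= ?iota_uniq ?mem_index_iota//.
  rewrite big1 ?adde0; last by move=> j ji; rewrite X0// eq_sym.
  exact: X2.
rewrite big_nat; apply: (@le_trans _ _ (\sum_(m <= i < n | (m <= i < n)%N) C%:E)%E).
  exact: lee_sum.
rewrite -big_nat sumEFin lee_fin.
by rewrite big_const_nat iter_addr_0 mulr_natr.
Qed.

Lemma sqr_sandwich K : exists n, (n ^ 2 <= K < n.+1 ^ 2)%N.
Proof.
elim: K => [|K [n /andP[nK Kn]]]; first by exists 0%N.
have [Kn'|Kn'] := ltnP K.+1 (n.+1 ^ 2); first by exists n; rewrite Kn' ltnW.
exists n.+1; rewrite Kn' (leq_ltn_trans Kn)//.
by rewrite ltn_exp2r.
Qed.

(** Between two consecutive squares n^2 <= K < (n+1)^2 the partial sum S(0, K) is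
    S(0, n^2) + S(n^2, K), and the square of the second term is dominated by the
    sum of the squares of all such increments.  This crude bound replaces a
    maximal inequality. *)
Lemma cvg_mean_along_squares (R : realType) (x : nat -> R) :
  let S m n := \sum_(m <= k < n) x k in
  (S 0%N (n ^ 2)%N ^+ 2 + \sum_((n ^ 2)%N <= k < (n.+1 ^ 2)%N) S (n ^ 2)%N k ^+ 2)
     / n%:R ^+ 4 @[n --> \oo] --> (0 : R) ->
  K%:R^-1 * S 0%N K @[K --> \oo] --> (0 : R).
Proof.
move=> S Z0.
apply/cvgr0Pnorm_lt => e e0.
have e20 : 0 < e ^+ 2 / 2 by rewrite divr_gt0// exprn_gt0.
have /cvgr0Pnorm_lt/(_ _ e20)[N _ NZ] := Z0.
exists (N.+1 ^ 2)%N => //= K NK.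
have [n /andP[nK Kn]] := sqr_sandwich K.
have Nn : (N < n)%N.
  by rewrite -ltnS -(@ltn_exp2r _ _ 2)// (leq_ltn_trans NK).
have n0 : (0 < n)%N by rewrite (leq_trans _ Nn).
have /= := NZ n (ltnW Nn).
set Y := (_ + _); rewrite ger0_norm; last first.
  by rewrite divr_ge0 ?exprn_ge0// addr_ge0 ?sqr_ge0// sumr_ge0// => i _; exact: sqr_ge0.
move=> YE.
have SK : S 0%N K ^+ 2 <= 2 * Y.
  have -> : S 0%N K = S 0%N (n ^ 2)%N + S (n ^ 2)%N K.
    by rewrite /S -big_cat_nat.
  have : S (n ^ 2)%N K ^+ 2 <= \sum_((n ^ 2)%N <= k < (n.+1 ^ 2)%N) S (n ^ 2)%N k ^+ 2.
    rewrite (bigD1_seq K)/= ?iota_uniq ?mem_index_iota ?nK//.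
    by rewrite lerDl sumr_ge0// => i _; exact: sqr_ge0.
  rewrite /Y; move: (S 0%N _) (S _ K) (\sum_(_ <= k < _) _) => a b c bc.
  by have := sqr_ge0 (a - b); nra.
have K0 : 0 < K%:R :> R by rewrite ltr0n (leq_trans _ nK)// expn_gt0 n0.
rewrite -(@ltr_pXn2r _ 2)// ?nnegrE ?normr_ge0 ?ltW//.
rewrite -normrX ger0_norm ?sqr_ge0// exprMn exprVn mulrC ltr_pdivrMr ?exprn_gt0//.
apply: (le_lt_trans SK).
have n40 : 0 < n%:R ^+ 4 :> R by rewrite exprn_gt0// ltr0n.
apply: (@lt_le_trans _ _ (e ^+ 2 * n%:R ^+ 4)).
  move: YE; rewrite ltr_pdivrMr//.
  by move: (n%:R ^+ 4) (Y) (e ^+ 2) => a b c; lra.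
rewrite ler_pM2l ?exprn_gt0// (exprM _ 2 2) lerXn2r ?nnegrE//.
by rewrite -natrX ler_nat.
Qed.

Lemma sum_inv_sqr_le (R : realType) n :
  \sum_(0 <= i < n) (i.+1%:R ^+ 2)^-1 <= 2 :> R.
Proof.
case: n => [|n]; first by rewrite big_geq.
suff : \sum_(0 <= i < n.+1) (i.+1%:R ^+ 2)^-1 <= 2 - n.+1%:R^-1 :> R.
  by move=> /le_trans; apply; rewrite gerBl.
elim: n => [|n IH]; first by rewrite big_nat1 expr1n; lra.
rewrite big_nat_recr//=; apply: (le_trans (lerD IH (lexx _))).
have a0 : 0 < n.+1%:R :> R by [].
rewrite -[n.+2]addn1 natrD; move: (n.+1%:R) a0 => a a0.
suff : ((a + 1) ^+ 2)^-1 <= a^-1 - (a + 1)^-1 by lra.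
have -> : a^-1 - (a + 1)^-1 = (a * (a + 1))^-1 by field; lra.
rewrite lef_pV2 ?posrE; [nra|nra|nra].
Qed.

(** Rajchman's argument.  There are about 2 n increments between n^2 and (n+1)^2,
    each of second moment at most about 2 n C, so that the functions Z n that
    control the mean along squares have integrals of order n^-2; these
    are summable and the Z n vanish almost everywhere. *)
Theorem slln_uncorrelated d (T : measurableType d) (R : realType)
    (mu : {measure set T -> \bar R}) (X : nat -> T -> R) (C : R) :
  (forall k, measurable_fun setT (X k)) ->
  (forall k, (\int[mu]_w (X k w ^+ 2)%:E <= C%:E)%E) ->
  (forall i j, i != j -> (\int[mu]_w (X i w * X j w)%:E = 0)%E) ->
  {ae mu, forall w, K%:R^-1 * \sum_(0 <= k < K) X k w @[K --> \oo] --> (0 : R)}.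
Proof.
move=> mX X2 X0.
have C0 : 0 <= C.
  rewrite -lee_fin (le_trans _ (X2 0%N))// integral_ge0// => w _.
  by rewrite lee_fin sqr_ge0.
pose S m n w := \sum_(m <= k < n) X k w.
have mS m n : measurable_fun setT (S m n) by exact: measurable_sum.
pose Z n w := (S 0%N (n ^ 2)%N w ^+ 2 +
    \sum_((n ^ 2)%N <= k < (n.+1 ^ 2)%N) S (n ^ 2)%N k w ^+ 2)
     / n%:R ^+ 4.
have Z0 n w : 0 <= Z n w.
  rewrite divr_ge0 ?exprn_ge0// addr_ge0 ?sqr_ge0// sumr_ge0// => i _.
  exact: sqr_ge0.
have mSS n : measurable_fun setT
    (fun w => S 0%N (n ^ 2)%N w ^+ 2 + \sum_((n ^ 2)%N <= k < (n.+1 ^ 2)%N) S (n ^ 2)%N k w ^+ 2).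
  apply: measurable_funD; first exact: measurable_funX.
  by apply: measurable_sum => k; exact: measurable_funX.
have mZ n : measurable_fun setT (Z n) by apply: measurable_funM.
have EZ n : (\int[mu]_w (Z n.+1 w)%:E <= (10 * C * (n.+1%:R ^+ 2)^-1)%:E)%E.
  set q := n.+1.
  have q0 : 0 < q%:R :> R by rewrite ltr0n.
  rewrite /Z; under eq_integral do rewrite mulrC EFinM.
  rewrite ge0_integralZl//; last 2 first.
  - exact/measurable_EFinP.
  - by move=> w _; rewrite lee_fin addr_ge0 ?sqr_ge0// sumr_ge0// => i _; exact: sqr_ge0.
  have -> : 10 * C * (q%:R ^+ 2)^-1 = (q%:R ^+ 4)^-1 * (10 * C * q%:R ^+ 2).
    by field; rewrite gt_eqF.
  rewrite EFinM lee_pmul2l ?fin_num// ?lte_fin ?invr_gt0 ?exprn_gt0//.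
  under eq_integral do rewrite EFinD -sumEFin.
  rewrite ge0_integralD//; last 4 first.
  - by move=> w _; rewrite lee_fin sqr_ge0.
  - by apply/measurable_EFinP; exact: measurable_funX.
  - by move=> w _; apply: sume_ge0 => i _; rewrite lee_fin sqr_ge0.
  - by apply: emeasurable_sum => i; apply/measurable_EFinP; exact: measurable_funX.
  rewrite ge0_integral_sum//; last 2 first.
  - by move=> k; apply/measurable_EFinP; exact: measurable_funX.
  - by move=> k w _; rewrite lee_fin sqr_ge0.
  apply: (@le_trans _ _ ((C * (q ^ 2 - 0)%N%:R)%:E +
      \sum_((q ^ 2)%N <= k < (q.+1 ^ 2)%N) (C * (2 * q + 1)%:R)%:E)%E).
    apply: leeD; first exact: integral_sqr_sum_uncorrelated.
    rewrite big_nat [leRHS]big_nat; apply: lee_sum => k /andP[qk kq].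
    apply: (le_trans (integral_sqr_sum_uncorrelated _ _ mX X2 X0)).
    rewrite lee_fin ler_wpM2l// ler_nat leq_subLR (leq_trans (ltnW kq))//.
    by rewrite -addn1 sqrnD exp1n muln1 -addnA (addnC 1).
  rewrite sumEFin -EFinD lee_fin subn0 big_const_nat iter_addr_0.
  rewrite -[_ *+ (_ - _)]mulr_natr.
  have -> : (q.+1 ^ 2 - q ^ 2 = 2 * q + 1)%N.
    by rewrite -addn1 sqrnD exp1n muln1 -addnA addKn addnC.
  have : 1 <= q%:R :> R by rewrite ler1n.
  rewrite natrX natrD natrM; move: (q%:R) => a a1.
  (* The block from q^2 to (q+1)^2 has length 2 q + 1, at most 3 q. *)
  have : a ^+ 2 + (2 * a + 1) ^+ 2 <= 10 * a ^+ 2 by nra.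
  by move/(ler_wpM2l C0); nra.
have : {ae mu, forall w, Z n.+1 w @[n --> \oo] --> (0 : R)}.
  apply: (@ae_cvg0_summable_integrals _ _ _ _ _ (10 * C * 2)) => // n.
  apply: (@le_trans _ _ (\sum_(0 <= i < n) (10 * C * (i.+1%:R ^+ 2)^-1)%:E)%E).
    exact: lee_sum.
  rewrite sumEFin lee_fin -mulr_sumr ler_wpM2l ?mulr_ge0// sum_inv_sqr_le//.
apply: filterS => w Zw; apply: cvg_mean_along_squares.
by rewrite -cvg_shiftS.
Qed.

(** * Taylor bounds for cosine, sine and exponential *)

Lemma integrable_bounded d (T : measurableType d) (R : realType)
    (P : probability T R) (f : T -> R) (b : R) :
  measurable_fun setT f -> (forall w, `|f w| <= b) ->
  P.-integrable setT (EFin \o f).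
Proof.
move=> mf fb; apply: measurable_bounded_integrable => //.
  by rewrite (le_lt_trans (probability_le1 _ _))// ltry.
exists b; split; first exact: num_real.
by move=> x bx w _ /=; rewrite (le_trans (fb w))// ltW.
Qed.

Lemma le_abs_sin (R : realType) (x : R) : `|sin x| <= `|x|.
Proof.
wlog x0 : x / 0 <= x => [h|].
  have [/h//|x0] := leP 0 x.
  by rewrite -normrN -sinN -(normrN x) h// oppr_ge0 ltW.
have [c _] := @MVT_segment R sin cos 0 x x0 (fun y _ => is_derive_sin y)
  (continuous_subspaceT (@continuous_sin R)).
rewrite sin0 !subr0 => ->.
by rewrite normrM ler_piMl// cos_max.
Qed.

Lemma cosB1E (R : realType) (x : R) : 1 - cos x = 2 * sin (x / 2) ^+ 2.
Proof.
have := cos2Dsin2 (x / 2); have := cosD (x / 2) (x / 2).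
have -> : x / 2 + x / 2 = x by lra.
by nra.
Qed.

Lemma abs_cosB1_le (R : realType) (x : R) : `|1 - cos x| <= x ^+ 2 / 2.
Proof.
rewrite cosB1E ger0_norm; last by rewrite mulr_ge0// sqr_ge0.
have : sin (x / 2) ^+ 2 <= (x / 2) ^+ 2.
  have := le_abs_sin (x / 2).
  by rewrite -(@ler_pXn2r _ 2) ?nnegrE// !real_normK ?num_real.
by move: (sin _ ^+ 2) => a; rewrite exprMn; nra.
Qed.

Lemma abs_sinB_le (R : realType) (x : R) : `|sin x - x| <= `|x| ^+ 3 / 2.
Proof.
wlog x0 : x / 0 <= x => [h|].
  have [/h//|x0] := leP 0 x.
  have := h (- x); rewrite sinN -opprD !normrN; apply.
  by rewrite oppr_ge0 ltW.
have cf : continuous (fun y : R => sin y - y).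
  by move=> y; apply: cvgB; [exact: continuous_sin|exact: cvg_id].
have [c cI] := @MVT_segment R (fun y => sin y - y) (fun y => cos y - 1) 0 x x0
  (fun y _ => is_deriveB (is_derive_sin y) (is_derive_id y 1))
  (continuous_subspaceT cf).
rewrite sin0 !subr0 => ->.
rewrite normrM (ger0_norm x0) exprSr mulrAC ler_wpM2r//.
rewrite distrC (le_trans (abs_cosB1_le c))// ler_wpM2r//.
by move: cI; rewrite in_itv/= => /andP[c0 cx]; rewrite lerXn2r// nnegrE.
Qed.

(** The cubic bound is used where a random variable is truncated, the quadratic
    one on its tail; the two together are what a Lindeberg argument needs. *)
Lemma abs_sin_taylor (R : realType) (x : R) :
  `|sin x - x| <= `|x| ^+ 3 /\ `|sin x - x| <= 2 * x ^+ 2.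
Proof.
have h := abs_sinB_le x.
have x0 := normr_ge0 x.
split; first by apply: (le_trans h); have := exprn_ge0 3 x0; lra.
rewrite -(real_normK (num_real x)).
have [x1|x1] := leP `|x| 1.
  by apply: (le_trans h); move: (`|x|) x0 x1 => a a0 a1; nra.
apply: (le_trans (ler_normB _ _)); have := sin_max x.
by move: (`|x|) x1 => a a1; nra.
Qed.

Lemma abs_cos_taylor (R : realType) (x : R) :
  `|cos x - (1 - x ^+ 2 / 2)| <= `|x| ^+ 3 /\
  `|cos x - (1 - x ^+ 2 / 2)| <= x ^+ 2.
Proof.
have hc := abs_cosB1_le x.
have c1 := cos_le1 x.
have -> : `|cos x - (1 - x ^+ 2 / 2)| = x ^+ 2 / 2 - (1 - cos x).
  rewrite ger0_norm; first by lra.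
  by move: hc; rewrite ler_norml => /andP[_]; lra.
have x0 := normr_ge0 x.
have e2 : x ^+ 2 / 2 - (1 - cos x) <= x ^+ 2 / 2 by lra.
split; last by apply: (le_trans e2); have := sqr_ge0 x; lra.
have [x1|x1] := leP `|x| 1; last first.
  apply: (le_trans e2); rewrite -(real_normK (num_real x)).
  by move: (`|x|) x1 => a a1; nra.
rewrite cosB1E.
set h := x / 2; have hE : x ^+ 2 / 2 = 2 * h ^+ 2 by rewrite /h; field.
rewrite hE.
have h1 := abs_sinB_le h; have h2 := le_abs_sin h.
have hx : `|h| = `|x| / 2 by rewrite normrM (@ger0_norm _ 2^-1)// invr_ge0.
apply: (@le_trans _ _ (2 * (`|sin h - h| * `|sin h + h|))).
  rewrite -normrM -mulrBr ler_pM2l// -subr_sqr distrC.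
  by rewrite (le_trans (ler_norm _))// distrC.
have h3 : `|sin h + h| <= 2 * `|h|.
  by rewrite (le_trans (ler_normD _ _))//; lra.
apply: (@le_trans _ _ (2 * (`|h| ^+ 3 / 2 * (2 * `|h|)))).
  by rewrite ler_pM2l// ler_pM.
rewrite hx; move: (`|x|) x0 x1 => a a0 a1.
have : a ^+ 4 <= a ^+ 3 by rewrite exprS ler_piMl ?exprn_ge0.
by have := exprn_ge0 3 a0; rewrite !exprMn; nra.
Qed.

Lemma expRN_taylor (R : realType) (u : R) : 0 <= u ->
  `|expR (- u) - (1 - u)| <= u ^+ 2.
Proof.
move=> u0; have := expR_ge1Dx (- u) => h1.
rewrite ger0_norm; last by lra.
have h2 := expR_ge1Dx u.
have : expR (- u) * (1 + u) <= 1.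
  rewrite (le_trans (ler_wpM2l (expR_ge0 _) h2))//.
  by rewrite -expRD addNr expR0.
have : 0 < expR (- u) by exact: expR_gt0.
move: (expR _) h1 => e h1 e0 eu.
have : (1 - u + u ^+ 2) * (1 + u) >= 1.
  by have := exprn_ge0 3 u0; nra.
nra.
Qed.

(** * Characteristic functions of weighted sums of independent variables *)

Lemma Rintegral_dist_le d (T : measurableType d) (R : realType)
    (mu : {measure set T -> \bar R}) (f g h : T -> R) :
  mu.-integrable setT (EFin \o f) -> mu.-integrable setT (EFin \o g) ->
  mu.-integrable setT (EFin \o h) ->
  (forall w, `|f w - g w| <= h w) ->
  `|\int[mu]_w f w - \int[mu]_w g w| <= \int[mu]_w h w.
Proof.
move=> if_ ig ih fgh; rewrite -RintegralB//.
have ifg : mu.-integrable setT (EFin \o (fun w => f w - g w)).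
  by have := integrableB measurableT if_ ig; apply: eq_integrable.
apply: (le_trans (le_normr_Rintegral _ _)) => //.
apply: le_Rintegral => //.
by have := integrable_abse ifg; apply: eq_integrable.
Qed.

Lemma Rintegral_cst_probability d (T : measurableType d) (R : realType)
    (P : probability T R) (r : R) : \int[P]_w r = r.
Proof. by rewrite /Rintegral integral_cst//= probability_setT mule1. Qed.

Lemma measurable_sqr_tail d (T : measurableType d) (R : realType) (Y : T -> R) (A : R) :
  measurable_fun setT Y ->
  measurable_fun setT (fun w => Y w ^+ 2 * (A < `|Y w|)%R%:R).
Proof.
move=> mY; apply: measurable_funM; first exact: measurable_funX.
rewrite (_ : (fun w => _) = \1_[set w | A < `|Y w|]); last first.
  by apply/funext => w; rewrite indicE mem_setE.
apply: measurable_indic; rewrite -[X in measurable X]setTI.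
have mnY : measurable_fun setT (fun w => `|Y w|) by exact: measurableT_comp.
rewrite (_ : [set w | _] = (fun w => `|Y w|) @^-1` `]A, +oo[).
  by apply: mnY => //; exact: measurable_itv.
by apply/seteqP; split=> w /=; rewrite in_itv/= andbT.
Qed.

(** Taylor expansion of cos (s Y) to second order and of sin (s Y) to first order,
    where Y is centered with second moment v.  On the event |Y| <= A the cubic
    remainder is at most |s|^3 A Y^2, and on its complement the quadratic remainder
    is paid by the tail of the second moment. *)
Lemma truncated_moment_trig d (T : measurableType d) (R : realType)
    (P : probability T R) (Y : T -> R) (v A eta s : R) :
  measurable_fun setT Y ->
  P.-integrable setT (EFin \o Y) -> P.-integrable setT (fun w => (Y w ^+ 2)%:E) ->
  \int[P]_w Y w = 0 -> \int[P]_w (Y w ^+ 2) = v ->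
  0 <= A -> \int[P]_w (Y w ^+ 2 * (A < `|Y w|)%R%:R) <= eta ->
  let B := `|s| ^+ 3 * A * v + 2 * s ^+ 2 * eta in
  `|\int[P]_w cos (s * Y w) - (1 - s ^+ 2 * v / 2)| <= B /\
  `|\int[P]_w sin (s * Y w)| <= B.
Proof.
move=> mY iY iY2 EY EY2 A0 tail B.
pose h y := `|s| ^+ 3 * A * y ^+ 2 + 2 * s ^+ 2 * (y ^+ 2 * (A < `|y|)%R%:R).
have bound (f : R -> R) : (forall x, `|f x| <= `|x| ^+ 3 /\ `|f x| <= 2 * x ^+ 2) ->
    forall y, `|f (s * y)| <= h y.
  move=> fb y; have [b1 b2] := fb (s * y); rewrite /h.
  have [Ay|yA] := ltP A `|y|.
    apply: (le_trans b2); rewrite mulr1 exprMn mulrA lerDr.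
    by rewrite mulr_ge0 ?sqr_ge0// mulr_ge0// exprn_ge0.
  apply: (le_trans b1); rewrite !mulr0 addr0 normrM exprMn -mulrA.
  by rewrite ler_wpM2l ?exprn_ge0// exprS real_normK ?num_real// ler_wpM2r ?sqr_ge0.
have msY : measurable_fun setT (fun w => s * Y w) by exact: measurable_funM.
have mcos : measurable_fun setT (fun w => cos (s * Y w)).
  apply: measurableT_comp msY => //.
  by apply: continuous_measurable_fun; exact: continuous_cos.
have msin : measurable_fun setT (fun w => sin (s * Y w)).
  apply: measurableT_comp msY => //.
  by apply: continuous_measurable_fun; exact: continuous_sin.
have icos : P.-integrable setT (EFin \o (fun w => cos (s * Y w))).
  by apply: (@integrable_bounded _ _ _ _ _ 1) => // w; exact: cos_max.
have isin : P.-integrable setT (EFin \o (fun w => sin (s * Y w))).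
  by apply: (@integrable_bounded _ _ _ _ _ 1) => // w; exact: sin_max.
have mtail := measurable_sqr_tail A mY.
have itail : P.-integrable setT (EFin \o (fun w => Y w ^+ 2 * (A < `|Y w|)%R%:R)).
  apply: (le_integrable _ _ _ iY2) => //; first exact/measurable_EFinP.
  move=> w _; rewrite /= lee_fin normrM ler_piMr//.
  by case: (A < _); rewrite ?normr1 ?normr0.
have iY2' : P.-integrable setT (EFin \o (fun w => Y w ^+ 2)) by [].
have ih : P.-integrable setT (EFin \o (fun w => h (Y w))).
  have := integrableD measurableT (integrableZl measurableT (`|s| ^+ 3 * A) iY2')
    (integrableZl measurableT (2 * s ^+ 2) itail).
  by apply: eq_integrable.
have Eh : \int[P]_w h (Y w) <= B.
  rewrite RintegralD//; first last.
  - by have := integrableZl measurableT (2 * s ^+ 2) itail; apply: eq_integrable.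
  - by have := integrableZl measurableT (`|s| ^+ 3 * A) iY2'; apply: eq_integrable.
  rewrite !RintegralZl// EY2 lerD2l; apply: ler_wpM2l => //.
  by apply: mulr_ge0 => //; exact: sqr_ge0.
have isY : P.-integrable setT (EFin \o (fun w => s * Y w)).
  by have := integrableZl measurableT s iY; apply: eq_integrable.
have isY2 : P.-integrable setT (EFin \o (fun w => s ^+ 2 / 2 * Y w ^+ 2)).
  by have := integrableZl measurableT (s ^+ 2 / 2) iY2'; apply: eq_integrable.
have i1 : P.-integrable setT (EFin \o (fun=> 1)).
  by apply: (@integrable_bounded _ _ _ _ _ 1) => // w; rewrite normr1.
split; apply: le_trans Eh.
  have -> : 1 - s ^+ 2 * v / 2 = \int[P]_w (1 - s ^+ 2 / 2 * Y w ^+ 2).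
    rewrite RintegralB// RintegralZl// EY2.
    by rewrite Rintegral_cst_probability mulrAC.
  apply: Rintegral_dist_le => //.
    by have := integrableB measurableT i1 isY2; apply: eq_integrable.
  move=> w; have -> : s ^+ 2 / 2 * Y w ^+ 2 = (s * Y w) ^+ 2 / 2.
    by rewrite exprMn mulrAC.
  apply: (bound (fun x => cos x - (1 - x ^+ 2 / 2))) => x.
  have [c1 c2] := abs_cos_taylor x; split => //.
  by apply: (le_trans c2); have := sqr_ge0 x; lra.
have -> : \int[P]_w sin (s * Y w) =
    \int[P]_w sin (s * Y w) - \int[P]_w (s * Y w).
  by rewrite RintegralZl// EY mulr0 subr0.
apply: Rintegral_dist_le => // w.
by apply: (bound (fun x => sin x - x)) => x; exact: abs_sin_taylor.
Qed.

(** Characteristic functions are handled through the real integrals of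
    cos (theta + X), with theta arbitrary: theta = 0 and theta = - pi / 2 give
    the real and imaginary parts.  Keeping theta free makes an induction on the
    number of summands possible without complex numbers, since by independence
    E cos (theta + S + s Y) = E cos (theta + S) E cos (s Y)
    - E sin (theta + S) E sin (s Y), where E sin (s Y) is negligible and E cos (s Y)
    is close to exp (- v s^2 / 2).  Each summand contributes its own error. *)
Lemma charfun_sum_independent d (T : measurableType d) (R : realType)
    (P : probability T R) (Y : nat -> {RV P >-> R}) (v A eta : R) :
  independent_RVs Y ->
  (forall k, P.-integrable setT (EFin \o Y k)) ->
  (forall k, P.-integrable setT (fun w => (Y k w ^+ 2)%:E)) ->
  (forall k, \int[P]_w Y k w = 0) -> (forall k, \int[P]_w (Y k w ^+ 2) = v) ->
  0 <= v -> 0 <= A ->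
  (forall k, \int[P]_w (Y k w ^+ 2 * (A < `|Y k w|)%R%:R) <= eta) ->
  forall (s : nat -> R) (K : nat) (theta : R),
  `|\int[P]_w cos (theta + \sum_(k < K) s k * Y k w) -
    expR (- (v / 2 * \sum_(k < K) s k ^+ 2)) * cos theta| <=
  \sum_(k < K) (2 * (`|s k| ^+ 3 * A * v + 2 * s k ^+ 2 * eta) +
                (v / 2 * s k ^+ 2) ^+ 2).
Proof.
move=> indY iY iY2 EY EY2 v0 A0 tail s K.
have mY k : measurable_fun setT (Y k) by [].
elim: K => [|K IH] theta.
  under eq_Rintegral do rewrite big_ord0 addr0.
  rewrite Rintegral_cst_probability !big_ord0 mulr0 oppr0 expR0.
  by rewrite mul1r subrr normr0.
pose S w := \sum_(k < K) s k * Y k w.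
have mS : measurable_fun setT S by apply: measurable_sum => k; exact: measurable_funM.
have mthS : measurable_fun setT (fun w => theta + S w) by exact: measurable_funD.
have mc : measurable_fun setT (@cos R).
  by apply: continuous_measurable_fun; exact: continuous_cos.
have ms : measurable_fun setT (@sin R).
  by apply: continuous_measurable_fun; exact: continuous_sin.
have msY : measurable_fun setT (fun w => s K * Y K w) by exact: measurable_funM.
have bi (f : R -> R) (X : T -> R) : measurable_fun setT X ->
    measurable_fun setT f -> (forall x, `|f x| <= 1) ->
    P.-integrable setT (EFin \o (fun w => f (X w))).
  move=> mX mf f1; apply: (@integrable_bounded _ _ _ _ _ 1) => //.
  exact: measurableT_comp.
have bi2 (f g : R -> R) : measurable_fun setT f -> (forall x, `|f x| <= 1) ->
    measurable_fun setT g -> (forall x, `|g x| <= 1) ->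
    P.-integrable setT (EFin \o (fun w => f (theta + S w) * g (s K * Y K w))).
  move=> mf f1 mg g1; apply: (@integrable_bounded _ _ _ _ _ 1) => //.
    by apply: measurable_funM; exact: measurableT_comp.
  by move=> w; rewrite normrM mulr_ile1.
have ind (f g : R -> R) : measurable_fun setT f -> (forall x, `|f x| <= 1) ->
    measurable_fun setT g -> (forall x, `|g x| <= 1) ->
    \int[P]_w (f (theta + S w) * g (s K * Y K w)) =
    \int[P]_w f (theta + S w) * \int[P]_w g (s K * Y K w).
  move=> mf f1 mg g1; apply: independent_pairM.
  - exact: measurableT_comp.
  - exact: measurableT_comp.
  - apply: (@independent_pair_comp _ _ _ _ S (Y K) (fun x => f (theta + x))
      (fun y => g (s K * y))).
    + by apply: measurableT_comp => //; exact: measurable_funD.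
    + by apply: measurableT_comp => //; exact: measurable_funM.
    + exact: independent_RVs_sum.
  - exact: bi.
  - exact: bi.
  - exact: bi2.
have E : \int[P]_w cos (theta + \sum_(k < K.+1) s k * Y k w) =
    \int[P]_w cos (theta + S w) * \int[P]_w cos (s K * Y K w) -
    \int[P]_w sin (theta + S w) * \int[P]_w sin (s K * Y K w).
  rewrite -!ind//; [|exact: sin_max|exact: sin_max|exact: cos_max|exact: cos_max].
  rewrite -RintegralB//; [|apply: bi2|apply: bi2] => //;
    try exact: cos_max; try exact: sin_max.
  apply: eq_Rintegral => w _; rewrite big_ord_recr/= addrA -/(S w).
  exact: cosD.
have [c1 s1] := truncated_moment_trig (s K) (mY K) (iY K) (iY2 K) (EY K) (EY2 K) A0 (tail K).
rewrite E !big_ord_recr/= mulrDr opprD expRD.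
have {IH} := IH theta.
rewrite -/S.
have u0 : 0 <= v / 2 * s K ^+ 2 by rewrite mulr_ge0 ?sqr_ge0// divr_ge0.
have := expRN_taylor u0.
have e1 : expR (- (v / 2 * s K ^+ 2)) <= 1 by rewrite expR_le1 oppr_le0.
have e0 := expR_ge0 (- (v / 2 * s K ^+ 2)).
have C1 : `|\int[P]_w cos (theta + S w)| <= 1.
  apply: (le_trans (le_normr_Rintegral _ _)) => //.
    by apply: bi => //; exact: cos_max.
  apply: (@le_trans _ _ (\int[P]_w cst 1 w)).
    apply: le_Rintegral => //.
    - have := @bi (@cos R) _ mthS mc (@cos_max R).
      by move=> /integrable_abse; apply: eq_integrable.
    - by apply: (@integrable_bounded _ _ _ _ _ 1) => // w; rewrite normr1.
    - by move=> w _; exact: cos_max.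
  by rewrite Rintegral_cst_probability.
have S1 : `|\int[P]_w sin (theta + S w)| <= 1.
  apply: (le_trans (le_normr_Rintegral _ _)) => //.
    by apply: bi => //; exact: sin_max.
  apply: (@le_trans _ _ (\int[P]_w cst 1 w)).
    apply: le_Rintegral => //.
    - have := @bi (@sin R) _ mthS ms (@sin_max R).
      by move=> /integrable_abse; apply: eq_integrable.
    - by apply: (@integrable_bounded _ _ _ _ _ 1) => // w; rewrite normr1.
    - by move=> w _; exact: sin_max.
  by rewrite Rintegral_cst_probability.
move: c1 s1; set B := (_ * A * v + _).
have -> : s K ^+ 2 * v / 2 = v / 2 * s K ^+ 2 by lra.
set u := v / 2 * s K ^+ 2 in u0 e1 e0 *.
set cS := \int[P]_w cos (theta + S w) in C1 *.
set sS := \int[P]_w sin (theta + S w) in S1 *.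
set cY := \int[P]_w cos _; set sY := \int[P]_w sin _.
set eu := expR (- u) in e1 e0 *; set eS := expR _; set ct := cos theta.
move=> c1 s1 t1 IH.
set D := \sum_(_ < _) (_ + _) in IH *.
have -> : cS * cY - sS * sY - eS * eu * ct =
  cS * (cY - (1 - u)) - cS * (eu - (1 - u)) + (cS - eS * ct) * eu - sS * sY by ring.
have a1 : `|cS * (cY - (1 - u))| <= B.
  by rewrite normrM (le_trans _ c1)// ler_piMl.
have a2 : `|cS * (eu - (1 - u))| <= u ^+ 2.
  by rewrite normrM (le_trans _ t1)// ler_piMl.
have a3 : `|(cS - eS * ct) * eu| <= D.
  by rewrite normrM (le_trans _ IH)// ler_piMr// ger0_norm.
have a4 : `|sS * sY| <= B.
  by rewrite normrM (le_trans _ s1)// ler_piMl.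
rewrite (le_trans (ler_normB _ _))// (le_trans (lerD (ler_normD _ _) (lexx _)))//.
rewrite (le_trans (lerD (lerD (ler_normB _ _) (lexx _)) (lexx _)))//.
by lra.
Qed.

(** Lindeberg's central limit theorem for triangular arrays of weights.  With
    |s K k| <= C / sqrt K the error terms add up to a quantity of order
    A / sqrt K + eta, where eta is the tail of the second moments beyond A; eta is
    made small first, uniformly in k, and K is taken large afterwards. *)
Lemma cvg_charfun_triangular d (T : measurableType d) (R : realType)
    (P : probability T R) (Y : nat -> {RV P >-> R}) (v C tau : R)
    (s : nat -> nat -> R) :
  independent_RVs Y ->
  (forall k, P.-integrable setT (EFin \o Y k)) ->
  (forall k, P.-integrable setT (fun w => (Y k w ^+ 2)%:E)) ->
  (forall k, \int[P]_w Y k w = 0) -> (forall k, \int[P]_w (Y k w ^+ 2) = v) ->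
  (forall eta : R, 0 < eta -> exists2 A : R, 0 <= A &
    forall k, \int[P]_w (Y k w ^+ 2 * (A < `|Y k w|)%R%:R) <= eta) ->
  0 <= v -> 0 <= C ->
  (\forall K \near \oo, forall k, (k < K)%N -> `|s K k| <= C / Num.sqrt K%:R) ->
  \sum_(k < K) s K k ^+ 2 @[K --> \oo] --> tau ->
  forall theta : R,
  \int[P]_w cos (theta + \sum_(k < K) s K k * Y k w) @[K --> \oo] -->
    expR (- (v / 2 * tau)) * cos theta.
Proof.
move=> indY iY iY2 EY EY2 UI v0 C0 sC stau theta.
have lim2 : expR (- (v / 2 * \sum_(k < K) s K k ^+ 2)) * cos theta @[K --> \oo] -->
    expR (- (v / 2 * tau)) * cos theta.
  apply: cvgM; last exact: cvg_cst.
  apply: continuous_cvg; first exact: continuous_expR.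
  by apply: cvgN; apply: cvgM => //; exact: cvg_cst.
set u := fun K => _ in lim2.
set x := fun K => \int[P]_w cos (theta + \sum_(k < K) s K k * Y k w).
suff diff0 : x K - u K @[K --> \oo] --> (0 : R).
  have -> : x = (fun K => (x K - u K) + u K) by apply/funext => K; rewrite subrK.
  by rewrite -[X in _ --> X]add0r; exact: cvgD.
apply/cvgr0Pnorm_lt => e e0.
have D0 : 0 < 8 * (C ^+ 2 + 1) by rewrite mulr_gt0// ltr_wpDl// sqr_ge0.
have eta0 : 0 < e / (8 * (C ^+ 2 + 1)) by rewrite divr_gt0.
have [A A0 tail] := UI _ eta0.
pose M := 2 * C ^+ 3 * A * v + (v / 2) ^+ 2 * C ^+ 4.
near=> K.
apply: (le_lt_trans (charfun_sum_independent indY iY iY2 EY EY2 v0 A0 tail (s K) K theta)).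
set eta := e / _ in eta0 tail *.
have K0 : (0 < K)%N by near: K; exists 1%N.
have sK : forall k, (k < K)%N -> `|s K k| <= C / Num.sqrt K%:R by near: K.
pose r : R := (Num.sqrt K%:R)^-1.
have q0 : 0 < Num.sqrt K%:R :> R by rewrite sqrtr_gt0 ltr0n.
have r0 : 0 < r by rewrite invr_gt0.
have r1 : r <= 1.
  by rewrite invf_le1// -[leLHS]sqrtr1 ler_sqrt ?ler1n// ler0n.
have Kr : K%:R * r ^+ 2 = 1.
  by rewrite /r exprVn sqr_sqrtr ?ler0n// divff// pnatr_eq0 -lt0n.
apply: (@le_lt_trans _ _ (\sum_(k < K) (2 * ((C * r) ^+ 3 * A * v + 2 * (C * r) ^+ 2 * eta) +
   (v / 2 * (C * r) ^+ 2) ^+ 2))).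
  apply: ler_sum => k _.
  have sk : `|s K k| <= C * r by exact: sK.
  have s0 := normr_ge0 (s K k).
  have Cr0 : 0 <= C * r by rewrite mulr_ge0// ltW.
  have s2 : s K k ^+ 2 <= (C * r) ^+ 2.
    by rewrite -(real_normK (num_real (s K k))) lerXn2r// nnegrE.
  apply: lerD.
    rewrite ler_pM2l//; apply: lerD.
      by rewrite -[leLHS]mulrA -[leRHS]mulrA ler_wpM2r ?mulr_ge0// lerXn2r// nnegrE.
    by rewrite ler_wpM2r ?(ltW eta0)// ler_pM2l.
  have v20 : 0 <= v / 2 by rewrite divr_ge0.
  have := ler_wpM2l v20 s2.
  by apply: lerXn2r; rewrite nnegrE; apply: mulr_ge0 => //; exact: sqr_ge0.
rewrite big_const_ord iter_addr_0 -[_ *+ K]mulr_natl.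
have -> : K%:R * (2 * ((C * r) ^+ 3 * A * v + 2 * (C * r) ^+ 2 * eta) +
   (v / 2 * (C * r) ^+ 2) ^+ 2) =
   (K%:R * r ^+ 2) * (2 * C ^+ 3 * A * v * r + 4 * C ^+ 2 * eta +
   (v / 2) ^+ 2 * C ^+ 4 * r ^+ 2) by ring.
rewrite Kr mul1r.
have eta2 : 4 * C ^+ 2 * eta < e / 2.
  rewrite /eta mulrA ltr_pdivrMr//; have := sqr_ge0 C.
  by move: (C ^+ 2) => c c0; nra.
have M0 : 0 <= M by rewrite addr_ge0// ?mulr_ge0 ?exprn_ge0// divr_ge0.
have Mr : M * r <= e / 2.
  have hK : M ^+ 2 <= (e / 2) ^+ 2 * K%:R.
    rewrite -ler_pdivrMl ?exprn_gt0 ?divr_gt0//.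
    by near: K; exact: nbhs_infty_ger.
  have e2 : 0 <= e / 2 by rewrite divr_ge0// ltW.
  have Mr0 : 0 <= M * r by rewrite mulr_ge0// ltW.
  suff : (M * r) ^+ 2 <= (e / 2) ^+ 2.
    by rewrite ler_sqr ?nnegrE.
  have -> : (e / 2) ^+ 2 = (e / 2) ^+ 2 * K%:R * r ^+ 2 by rewrite -mulrA Kr mulr1.
  by rewrite exprMn; apply: ler_wpM2r => //; exact: sqr_ge0.
have : (v / 2) ^+ 2 * C ^+ 4 * r ^+ 2 <= (v / 2) ^+ 2 * C ^+ 4 * r.
  by rewrite ler_wpM2l ?mulr_ge0 ?sqr_ge0 ?exprn_ge0// expr2 ler_piMl// ltW.
by move: Mr; rewrite /M mulrDl; lra.
Unshelve. all: by end_near.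
Qed.

(** On the event |Y| > A one has Y^2 <= |Y|^(2 + delta) / A^delta. *)
Lemma uniform_integrability_moment d (T : measurableType d) (R : realType)
    (P : probability T R) (Y : nat -> T -> R) (delta b : R) :
  (forall k, measurable_fun setT (Y k)) -> 0 < delta ->
  (forall k, ('E_P[(fun w => `|Y k w| `^ (2 + delta))%R] <= b%:E)%E) ->
  forall eta : R, 0 < eta -> exists2 A : R, 0 <= A &
    forall k, \int[P]_w (Y k w ^+ 2 * (A < `|Y k w|)%R%:R) <= eta.
Proof.
move=> mY d0 mom eta eta0.
have b0 : 0 <= b.
  by rewrite -lee_fin (le_trans _ (mom 0%N))// expectation_ge0// => w; exact: powR_ge0.
have q0 : 0 < (b + 1) / eta by rewrite divr_gt0// ltr_wpDl.
(* With this level, b / A^delta < eta; the term + 1 covers the case b = 0. *)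
pose A := ((b + 1) / eta) `^ delta^-1.
have A0 : 0 < A by exact: powR_gt0.
have Ad : A `^ delta = (b + 1) / eta.
  by rewrite /A -powRrM mulVf ?gt_eqF// powRr1// ltW.
exists A; first exact: ltW.
move=> k; rewrite -lee_fin.
have mp : measurable_fun setT (fun w => `|Y k w| `^ (2 + delta)).
  by apply: (measurableT_comp (measurable_powR _)); exact: measurableT_comp.
have mtail := measurable_sqr_tail A (mY k).
have c0 : 0 <= eta / (b + 1) by rewrite divr_ge0 ?ltW// ltr_wpDl.
have key : (\int[P]_w (Y k w ^+ 2 * (A < `|Y k w|)%R%:R)%:E <= eta%:E)%E.
  apply: (@le_trans _ _ (\int[P]_w ((eta / (b + 1))%:E * (`|Y k w| `^ (2 + delta))%:E))%E).
    apply: ge0_le_integral => //.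
    - by move=> w _; rewrite lee_fin mulr_ge0 ?sqr_ge0.
    - exact/measurable_EFinP.
    - by apply/measurable_EFinP; exact: measurable_funM.
    - move=> w _; rewrite -EFinM lee_fin.
      have [AY|_] := ltP A `|Y k w|; last by rewrite mulr0 mulr_ge0 ?powR_ge0.
      have Y0 : 0 < `|Y k w| by exact: lt_trans AY.
      rewrite mulr1 powRD; last by apply/implyP => _; rewrite gt_eqF.
      rewrite powR_mulrn// real_normK ?num_real// mulrCA.
      rewrite ler_peMr ?sqr_ge0//.
      rewrite [leLHS](_ : _ = eta / (b + 1) * ((b + 1) / eta)); last first.
        by field; rewrite !gt_eqF ?ltr_wpDl.
      by rewrite ler_wpM2l// -Ad ge0_ler_powR ?nnegrE// ?ltW.
  rewrite ge0_integralZl//; last exact/measurable_EFinP.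
  have := mom k; rewrite unlock => mk.
  apply: (le_trans (lee_wpmul2l _ mk)); first by rewrite lee_fin.
  rewrite -EFinM lee_fin mulrAC -mulrA ler_piMr ?ltW//.
  by rewrite ltr_pdivrMr ?ltr_wpDl// mul1r ltrDl.
rewrite /Rintegral fineK//.
rewrite ge0_fin_numE; first by rewrite (le_lt_trans key)// ltry.
by apply: integral_ge0 => w _; rewrite lee_fin mulr_ge0 ?sqr_ge0.
Qed.

(** * The characteristic function of the normal density *)

(** The normal law is given by its density; its Radon-Nikodym derivative agrees
    with that density almost everywhere. *)
Lemma integral_normal_prob (R : realType) (m s : R) (f : R -> \bar R) :
  measurable_fun setT f -> (\int[normal_prob m s]_x `|f x| < +oo)%E ->
  (\int[normal_prob m s]_x f x =
   \int[lebesgue_measure]_x (f x * (normal_pdf m s x)%:E))%E.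
Proof.
move=> mf finf.
rewrite -(Radon_Nikodym_change_of_variables (normal_prob_dominates m s))//=; last first.
  by apply/integrableP; split.
have dom := normal_prob_dominates m s.
apply: ae_eq_integral => //.
- apply: emeasurable_funM; first exact: mf.
  apply: (measurable_int lebesgue_measure).
  by apply: Radon_Nikodym_integrable; exact: dom.
- apply: emeasurable_funM; first exact: mf.
  by apply/measurable_EFinP; exact: measurable_normal_pdf.
- apply: ae_eqe_mul2l => /=.
  rewrite Radon_NikodymE//=.
  case: cid => /= h [h1 h2 h3].
  apply: integral_ae_eq => //=.
  + by apply/measurable_EFinP; exact: measurable_normal_pdf.
  + by move=> E E01 mE; rewrite -h3.
Qed.

(** The integral of f = F' over [-n, n] is F n - F (- n), and dominated convergence
    lets n go to infinity. *)
Lemma integral_derivative_vanishing (R : realType) (F f : R -> R) :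
  (forall x, is_derive x (1 : R) F (f x)) -> continuous f ->
  lebesgue_measure.-integrable setT (EFin \o f) ->
  F n%:R @[n --> \oo] --> (0 : R) -> F (- n%:R) @[n --> \oo] --> (0 : R) ->
  (\int[lebesgue_measure]_x (f x)%:E = 0)%E.
Proof.
move=> dF cf if_ F1 F2.
have cF : continuous F.
  by move=> x; apply/differentiable_continuous/derivable1_diffP.
pose I n : set R := [set` `[- n.+1%:R, n.+1%:R]].
pose fn n x := (f x * \1_(I n) x)%:E.
have mf : measurable_fun setT f by exact: continuous_measurable_fun.
have mfn n : measurable_fun setT (fn n).
  apply/measurable_EFinP; apply: measurable_funM; first exact: mf.
  by apply: measurable_indic; exact: measurable_itv.
have fnf x : fn n x @[n --> \oo] --> (f x)%:E.
  apply: cvg_near_cst; near=> n.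
  rewrite /fn indicE mem_set ?mulr1//= /I/= in_itv/= -ler_norml.
  apply: (@le_trans _ _ n%:R); last by rewrite ler_nat.
  by near: n; exact: nbhs_infty_ger.
have fnb x n : (`|fn n x| <= `|(f x)%:E|)%E.
  by rewrite /fn/= lee_fin normrM ler_piMr// indicE; case: (x \in _); rewrite ?normr1 ?normr0.
have mfE : measurable_fun setT (EFin \o f) by exact/measurable_EFinP.
have lim : (\int[lebesgue_measure]_x fn n x @[n --> \oo] -->
    \int[lebesgue_measure]_x (f x)%:E)%E.
  case: (@dominated_convergence _ _ _ (@lebesgue_measure R) setT measurableT
    fn (EFin \o f) (fun x => `|(f x)%:E|%E)) => //.
  - by apply: aeW => x _; exact: fnf.
  - exact: integrable_abse.
  - by apply: aeW => x n _; exact: fnb.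
apply/esym; apply: (cvg_unique _ _ lim) => //.
have -> : (fun n => \int[lebesgue_measure]_x fn n x)%E =
    (fun n => (F n.+1%:R - F (- n.+1%:R))%:E).
  apply/funext => n /=.
  transitivity (\int[lebesgue_measure]_(x in I n) (f x)%:E)%E.
    rewrite [RHS]integral_mkcond; apply: eq_integral => x _.
    by rewrite /fn patchE indicE; case: (x \in _); rewrite ?mulr1 ?mulr0.
  rewrite /I (@continuous_FTC2 _ f F)//.
  - by rewrite gt0_cp.
  - exact: continuous_subspaceT.
  - split => //.
    + by apply: cvg_at_right_filter; exact: cF.
    + by apply: cvg_at_left_filter; exact: cF.
  - by move=> x _; rewrite derive1E; exact: derive_val.
apply: cvg_EFin; first exact: nearW.
rewrite -[X in _ --> X](subrr 0).
by apply: cvgB; [move: F1|move: F2]; rewrite -cvg_shiftS.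
Unshelve. all: by end_near.
Qed.

Section normal.
Context (R : realType) (s : R).
Hypothesis s0 : s != 0.
Local Notation g := (normal_pdf 0 s).

Lemma normal_pdf_formula x :
  g x = normal_peak s * expR (- (x ^+ 2 / (2 * s ^+ 2))).
Proof. by rewrite normal_pdfE// /normal_fun subr0 mulNr -mulr_natl. Qed.

Lemma is_derive_normal_pdf x :
  is_derive x (1 : R) g (- (x / s ^+ 2) * g x).
Proof.
have -> : g = fun x => normal_peak s * expR (- (x ^+ 2 / (2 * s ^+ 2))).
  by apply/funext => y; exact: normal_pdf_formula.
apply: is_derive_eq.
rewrite /GRing.scale/= !mulr1 mulr0 add0r.
by field.
Qed.

(** u exp (- u) <= 1, with u = x^2 / (2 s^2). *)
Lemma normal_pdf_decay x : x ^+ 2 * g x <= 2 * s ^+ 2 * normal_peak s.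
Proof.
rewrite normal_pdf_formula.
have s2 : 0 < s ^+ 2 by rewrite exprn_even_gt0.
set u := x ^+ 2 / (2 * s ^+ 2).
have -> : x ^+ 2 = 2 * s ^+ 2 * u by rewrite /u; field.
have u1 : u * expR (- u) <= 1.
  rewrite expRN ler_pdivrMr ?expR_gt0// mul1r.
  by have := expR_ge1Dx u; lra.
rewrite -mulrA [u * _]mulrCA; apply: ler_wpM2l; first by rewrite mulr_ge0// ltW.
by apply: ler_piMr => //; exact: normal_peak_ge0.
Qed.

(** x^2 times the density of deviation s is dominated by a multiple of the density
    of deviation 2 s, which is integrable. *)
Lemma integrable_sqr_normal_pdf :
  lebesgue_measure.-integrable setT (fun x : R => (x ^+ 2 * g x)%:E).
Proof.
have s2 : 0 < s ^+ 2 by rewrite exprn_even_gt0.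
have s20 : 2 * s != 0 by rewrite mulf_neq0.
pose C := 8 * s ^+ 2 * normal_peak s / normal_peak (2 * s).
have C0 : 0 <= C.
  by rewrite divr_ge0 ?normal_peak_ge0// mulr_ge0 ?normal_peak_ge0// mulr_ge0// ltW.
apply: (le_integrable _ _ _ (integrableZl measurableT C (integrable_normal_pdf 0 (2 * s)))) => //.
  apply/measurable_EFinP; apply: measurable_funM; last exact: measurable_normal_pdf.
  exact: measurable_funX.
move=> x _; rewrite -EFinM /= lee_fin.
rewrite ger0_norm; last by apply: mulr_ge0; [exact: sqr_ge0|exact: normal_pdf_ge0].
rewrite ger0_norm; last by apply: mulr_ge0 => //; exact: normal_pdf_ge0.
rewrite normal_pdf_formula// normal_pdfE// /normal_fun subr0.
rewrite /C [_ / _ * _]mulrA divfK ?gt_eqF ?normal_peak_gt0//.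
set v := x ^+ 2 / (8 * s ^+ 2).
have -> : x ^+ 2 / (2 * s ^+ 2) = 4 * v by rewrite /v; field.
have -> : - x ^+ 2 / ((2 * s) ^+ 2 *+ 2) = - v by rewrite /v; field.
have -> : x ^+ 2 = 8 * s ^+ 2 * v by rewrite /v; field.
have -> : - (4 * v) = - (3 * v) + - v by lra.
have -> : 8 * s ^+ 2 * v * (normal_peak s * expR (- (3 * v) + - v)) =
    8 * s ^+ 2 * normal_peak s * expR (- v) * (v * expR (- (3 * v))).
  by rewrite expRD; ring.
apply: ler_piMr.
  apply: mulr_ge0; last exact: expR_ge0.
  by apply: mulr_ge0; [rewrite mulr_ge0// ltW|exact: normal_peak_ge0].
rewrite expRN ler_pdivrMr ?expR_gt0// mul1r.
have v0 : 0 <= v by apply: divr_ge0; [exact: sqr_ge0|rewrite mulr_ge0// ltW].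
by have := expR_ge1Dx (3 * v); lra.
Qed.

Lemma integrable_normal_pdf_bounded_by (h : R -> R) :
  measurable_fun setT h -> (forall x, `|h x| <= 1 + x ^+ 2) ->
  lebesgue_measure.-integrable setT (fun x : R => (h x * g x)%:E).
Proof.
move=> mh hb.
apply: (le_integrable _ _ _ (integrableD measurableT
  (integrable_normal_pdf 0 s) integrable_sqr_normal_pdf)) => //.
  apply/measurable_EFinP; apply: measurable_funM; first exact: mh.
  exact: measurable_normal_pdf.
move=> x _; rewrite -EFinD /= lee_fin normrM.
have g0 := normal_pdf_ge0 0 s x.
have x2 : 0 <= x ^+ 2 by exact: sqr_ge0.
rewrite (ger0_norm g0) [leRHS]ger0_norm; last by rewrite addr_ge0// mulr_ge0.
by rewrite -[X in X + _]mul1r -mulrDl ler_wpM2r.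
Qed.

Lemma cvg_normal_pdf_nat (h : R -> R) (u : nat -> R) :
  (forall n, u n ^+ 2 = n%:R ^+ 2) -> (forall x, `|h x| <= 1) ->
  g (u n) * h (u n) @[n --> \oo] --> (0 : R).
Proof.
move=> uE h1; rewrite -cvg_shiftS.
pose C := 2 * s ^+ 2 * normal_peak s.
have C0 : 0 <= C by rewrite mulr_ge0 ?normal_peak_ge0// mulr_ge0// sqr_ge0.
apply: norm_cvg0; apply: (@squeeze_cvgr _ _ _ _ (cst 0) (fun n => C * n.+1%:R^-1)).
- apply: nearW => n; rewrite normr_ge0/= normrM ger0_norm ?normal_pdf_ge0//.
  apply: (@le_trans _ _ (g (u n.+1))); first by rewrite ler_piMr// normal_pdf_ge0.
  have := normal_pdf_decay (u n.+1); rewrite uE -/C => gC.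
  rewrite ler_pdivlMr//; apply: le_trans gC; rewrite mulrC ler_wpM2r ?normal_pdf_ge0//.
  by rewrite expr2 ler_peMl// ler1n.
- exact: cvg_cst.
- rewrite -[X in _ --> X](mulr0 C); apply: cvgM; first exact: cvg_cst.
  exact: cvg_harmonic.
Qed.

Let measurable_trig (f : R -> R) (theta t : R) : continuous f ->
  measurable_fun setT (fun x : R => f (theta + t * x)).
Proof.
move=> cf; apply: measurableT_comp.
  exact: continuous_measurable_fun.
by apply: measurable_funD => //; exact: measurable_funM.
Qed.

Let normr_le1Dsqr (x : R) : `|x| <= 1 + x ^+ 2.
Proof.
rewrite -(real_normK (num_real x)); have := normr_ge0 x.
by move: (`|x|) => a a0; have := sqr_ge0 (1 - a); nra.
Qed.

(** Integration by parts: the derivative of g x * sin (theta + t x) is integrable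
    and its primitive vanishes at infinity, so its integral is 0. *)
Lemma stein_normal theta t :
  \int[lebesgue_measure]_x (- (x * sin (theta + t * x)) * g x) =
  - (s ^+ 2 * t) * \int[lebesgue_measure]_x (cos (theta + t * x) * g x).
Proof.
pose i1 x := - (x * sin (theta + t * x)) * g x.
pose i2 x := cos (theta + t * x) * g x.
have ii1 : lebesgue_measure.-integrable setT (EFin \o i1).
  apply: integrable_normal_pdf_bounded_by.
    apply: measurableT_comp => //; apply: measurable_funM => //.
    exact: measurable_trig (@continuous_sin R).
  move=> x; rewrite normrN normrM (le_trans _ (normr_le1Dsqr x))//.
  by rewrite ler_piMr// sin_max.
have ii2 : lebesgue_measure.-integrable setT (EFin \o i2).
  apply: integrable_normal_pdf_bounded_by.
    exact: measurable_trig (@continuous_cos R).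
  by move=> x; rewrite (le_trans (cos_max _))// lerDl sqr_ge0.
pose F x := g x * sin (theta + t * x).
pose f x := (s ^+ 2)^-1 * i1 x + t * i2 x.
have dF x : is_derive x (1 : R) F (f x).
  have h1 := is_derive_normal_pdf x.
  have h2 : is_derive x (1 : R) (fun x => sin (theta + t * x)) (t * cos (theta + t * x)).
    apply: is_derive_eq; rewrite /GRing.scale/=.
    ring.
  apply: is_derive_eq; rewrite /f /i1 /i2 /GRing.scale/=.
  by field.
have cg : continuous g := continuous_normal_pdf s0.
have clin : continuous (fun x : R => theta + t * x).
  move=> x; apply: cvgD; first exact: cvg_cst.
  by apply: cvgM; [exact: cvg_cst|exact: cvg_id].
have csin : continuous (fun x : R => sin (theta + t * x)).
  by move=> x; apply: continuous_comp; [exact: clin|exact: continuous_sin].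
have ccos : continuous (fun x : R => cos (theta + t * x)).
  by move=> x; apply: continuous_comp; [exact: clin|exact: continuous_cos].
have cf : continuous f.
  move=> x; apply: cvgD; apply: cvgM; [exact: cvg_cst| |exact: cvg_cst|].
    apply: cvgM; last exact: cg.
    by apply: cvgN; apply: cvgM; [exact: cvg_id|exact: csin].
  by apply: cvgM; [exact: ccos|exact: cg].
have if_ : lebesgue_measure.-integrable setT (EFin \o f).
  have := integrableD measurableT (integrableZl measurableT (s ^+ 2)^-1 ii1)
    (integrableZl measurableT t ii2).
  by apply: eq_integrable.
have sin1 x : `|sin (theta + t * x)| <= 1 by exact: sin_max.
have F1 : F n%:R @[n --> \oo] --> (0 : R).
  exact: (@cvg_normal_pdf_nat (fun x => sin (theta + t * x))).
have F2 : F (- n%:R) @[n --> \oo] --> (0 : R).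
  apply: (@cvg_normal_pdf_nat (fun x => sin (theta + t * x)) (fun n => - n%:R)) => // n.
  by rewrite sqrrN.
have := integral_derivative_vanishing dF cf if_ F1 F2.
move=> /(congr1 fine); rewrite -/(Rintegral _ _ _) /f RintegralD//; first last.
- by have := integrableZl measurableT t ii2; apply: eq_integrable.
- by have := integrableZl measurableT (s ^+ 2)^-1 ii1; apply: eq_integrable.
rewrite !RintegralZl// /= => /eqP; rewrite addr_eq0 => /eqP h.
rewrite -/(i1 _) -/(i2 _).
have s2 : s ^+ 2 != 0 by rewrite expf_neq0.
transitivity (s ^+ 2 * ((s ^+ 2)^-1 * \int[lebesgue_measure]_x i1 x)).
  by rewrite mulVKf.
by rewrite h; ring.
Qed.

Lemma is_derive_charfun_normal theta t :
  is_derive t (1 : R)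
    (fun t => \int[lebesgue_measure]_x (cos (theta + t * x) * g x))
    (- (s ^+ 2 * t) * \int[lebesgue_measure]_x (cos (theta + t * x) * g x)).
Proof.
pose f t x := cos (theta + t * x) * g x.
have df u x : is_derive u (1 : R) (f ^~ x) (- (x * sin (theta + u * x)) * g x).
  have h2 : is_derive u (1 : R) (fun u => cos (theta + u * x)) (- (x * sin (theta + u * x))).
    by apply: is_derive_eq; rewrite /GRing.scale/=; ring.
  by apply: is_derive_eq; rewrite /GRing.scale/=; ring.
have d1f u x : partial1of2 f u x = - (x * sin (theta + u * x)) * g x.
  by rewrite partial1of2E; exact: derive_val.
have tI : `]t - 1, t + 1[%classic t by rewrite /= in_itv/= ltrBlDr !ltrDl ltr01.
have intf u : `]t - 1, t + 1[%classic u -> lebesgue_measure.-integrable setT (EFin \o f u).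
  move=> _; apply: integrable_normal_pdf_bounded_by.
    exact: measurable_trig (@continuous_cos R).
  by move=> x; rewrite (le_trans (cos_max _))// lerDl sqr_ge0.
pose G x := (1 + x ^+ 2) * g x.
have G0 x : 0 <= G x.
  by apply: mulr_ge0; [rewrite addr_ge0// sqr_ge0|exact: normal_pdf_ge0].
have intG : lebesgue_measure.-integrable setT (EFin \o G).
  apply: integrable_normal_pdf_bounded_by.
    by apply: measurable_funD => //; exact: measurable_funX.
  by move=> x; rewrite ger0_norm// addr_ge0// sqr_ge0.
have Gub u x : `]t - 1, t + 1[%classic u -> setT x -> `|partial1of2 f u x| <= G x.
  move=> _ _; rewrite d1f normrM (ger0_norm (normal_pdf_ge0 0 s x)).
  apply: ler_wpM2r; first exact: normal_pdf_ge0.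
  rewrite normrN normrM (le_trans _ (normr_le1Dsqr x))//.
  by rewrite ler_piMr// sin_max.
have derf u x : `]t - 1, t + 1[%classic u -> setT x -> derivable (f ^~ x) u 1.
  by move=> _ _; have [] := df u x.
apply: DeriveDef.
  exact: (derivable_under_integral measurableT tI intf derf G0 intG Gub).
rewrite -derive1E.
rewrite (differentiation_under_integral measurableT tI intf derf G0 intG Gub).
rewrite -stein_normal.
by apply: eq_Rintegral => x _; rewrite d1f.
Qed.

(** As a function of t, the left-hand side solves psi' = - s^2 t psi, by
    differentiation under the integral and Stein's identity; hence its product with
    exp (s^2 t^2 / 2) is constant. *)
Lemma charfun_normal_pdf theta t :
  \int[lebesgue_measure]_x (cos (theta + t * x) * g x) =
  expR (- (s ^+ 2 * t ^+ 2 / 2)) * cos theta.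
Proof.
pose psi u := \int[lebesgue_measure]_x (cos (theta + u * x) * g x).
pose h u := psi u * expR (s ^+ 2 * u ^+ 2 / 2).
have dh u : is_derive u (1 : R) h 0.
  have h1 := is_derive_charfun_normal theta u.
  have h2 : is_derive u (1 : R) (fun u => expR (s ^+ 2 * u ^+ 2 / 2))
      (s ^+ 2 * u * expR (s ^+ 2 * u ^+ 2 / 2)).
    by apply: is_derive_eq; rewrite /GRing.scale/=; field.
  by apply: is_derive_eq; rewrite /GRing.scale/= -/(psi u); ring.
have := is_derive_0_is_cst t 0 dh.
rewrite /h expr0n/= mulr0 mul0r expR0 mulr1 => e.
have p0 : psi 0 = cos theta.
  rewrite /psi; under eq_Rintegral do rewrite mul0r addr0.
  rewrite RintegralZl//; last exact: integrable_normal_pdf.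
  by rewrite /Rintegral integral_normal_pdf mulr1.
by rewrite expRN -p0 -e mulrC mulfK// gt_eqF// expR_gt0.
Qed.

End normal.

(** * Limits, continuity and Borel measurability in R^n *)

Lemma cvg_mx (R : realType) (T : Type) (F : set_system T) {FF : Filter F} m n
    (f : T -> 'M[R]_(m, n)) (A : 'M[R]_(m, n)) :
  (forall i j, f x i j @[x --> F] --> A i j) -> f x @[x --> F] --> A.
Proof.
move=> fA; apply/cvg_ballP => e e0.
have H : \forall x \near F, forall i j, ball (A i j) e (f x i j).
  apply: filter_forall => i; apply: filter_forall => j.
  by have /cvg_ballP := fA i j; apply.
by apply: filterS H => x fx; split.
Qed.

Lemma cvg_mx_coord (R : realType) (T : Type) (F : set_system T) {FF : Filter F} m n
    (f : T -> 'M[R]_(m, n)) (A : 'M[R]_(m, n)) i j :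
  f x @[x --> F] --> A -> f x i j @[x --> F] --> A i j.
Proof.
move=> fA; exact: (@cvg_comp _ _ _ f (fun M : 'M[R]_(m, n) => M i j) F _ _ fA
  (@coord_continuous R m n i j A)).
Qed.

Lemma continuous_mx (R : realType) (T : topologicalType) m n
    (f : T -> 'M[R]_(m, n)) :
  (forall i j, continuous (fun x => f x i j)) -> continuous f.
Proof. by move=> cf x; apply: cvg_mx => i j; exact: cf. Qed.

(** The norm on matrices is the sup norm, so its balls are boxes, and those with
    rational center and radius form a countable base.  This reduces Borel
    measurability of random vectors to measurability of their coordinates. *)
Lemma open_rational_boxes (R : realType) n (U : set 'cV[R]_n) : open U ->
  U = \bigcup_(q in [set q : 'cV[rat]_n * rat |
        ball (map_mx ratr q.1 : 'cV[R]_n) (ratr q.2) `<=` U])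
      ball (map_mx ratr q.1 : 'cV[R]_n) (ratr q.2).
Proof.
move=> oU; apply/seteqP; split; last by move=> x [q /= qU]; exact: qU.
move=> x Ux.
have /nbhs_ballP[e /= e0 eU] : nbhs x U by apply: open_nbhs_nbhs.
have [r /itvP r_e] : exists r : rat, ratr r \in `]0, (e / 2)[.
  have [r] := @rat_in_itvoo R 0 (e / 2) (divr_gt0 e0 (ltr0Sn _ 1)).
  by exists r.
have r0 : 0 < (ratr r : R) by rewrite r_e.
have [q qx] : exists q : 'I_n -> rat, forall i, `|ratr (q i) - x i 0| < (ratr r : R).
  suff /choice[q qx] : forall i, exists q : rat, `|ratr q - x i 0| < (ratr r : R).
    by exists q.
  move=> i; have xi : x i 0 - ratr r < x i 0 + ratr r by rewrite ltrD2l; lra.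
  have [q] := rat_in_itvoo xi; rewrite in_itv/= => /andP[q1 q2].
  by exists q; rewrite ltr_distl q1.
have xq : ball (map_mx ratr (\col_i q i) : 'cV[R]_n) (ratr r) x.
  split => // i j; rewrite ord1 !mxE; exact: qx.
exists (\col_i q i, r) => //= z [_ qz]; apply: eU; split => // i j.
have := qz i j; have [_ xqij] := xq; have := xqij i j.
rewrite /ball/= => h1 h2.
have h3 : (ratr r : R) < e / 2 by rewrite r_e.
rewrite (splitr e) -(subrKA (map_mx ratr (\col_i q i) i j : R)).
rewrite (le_lt_trans (ler_normD _ _))// ltrD//; last exact: lt_trans h3.
by rewrite distrC; exact: lt_trans h3.
Qed.

Lemma measurable_fun_borel_cV d (T : measurableType d) (R : realType) n
    (X : T -> 'cV[R]_n) :
  (forall i, measurable_fun setT (fun w => X w i 0)) ->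
  measurable_fun setT (X : T -> borel 'cV[R]_n).
Proof.
move=> mX.
apply: (@measurability _ _ _ (borel 'cV[R]_n) setT X (@open 'cV[R]_n)) => //.
move=> _ [U oU <-]; rewrite setTI (open_rational_boxes oU) preimage_bigcup.
rewrite bigcup_mkcond.
apply: countable_bigcupT_measurable => [|q]; first exact: countableP.
case: ifPn => // _.
have [r0|r0] := ltP 0 (ratr q.2 : R); last first.
  rewrite (_ : _ @^-1` _ = set0)//; apply/seteqP; split => // w [].
  by rewrite ltNge r0.
rewrite (_ : _ @^-1` _ = \bigcap_(i in [set: 'I_n])
    [set w | `|(ratr (q.1 i 0) : R) - X w i 0| < ratr q.2]).
  apply: fin_bigcap_measurable => [//|i _].
  rewrite -[X in measurable X]setTI.
  have mi : measurable_fun setT (fun w => `|(ratr (q.1 i 0) : R) - X w i 0|).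
    by apply: measurableT_comp => //; exact: measurable_funB.
  rewrite (_ : [set w | _] = (fun w => `|(ratr (q.1 i 0) : R) - X w i 0|) @^-1` `]-oo, ratr q.2[).
    by apply: mi => //; exact: measurable_itv.
  by apply/seteqP; split=> w /=; rewrite in_itv.
apply/seteqP; split => w /=.
  by move=> [_ h] i _; have := h i 0; rewrite mxE.
by move=> h; split => // i j; rewrite ord1 mxE; exact: h.
Qed.

Lemma continuous_measurable_borel (R : realType) (U : ptopologicalType) (f : U -> R) :
  continuous f -> measurable_fun setT (f : borel U -> R).
Proof.
move=> cf; apply: (measurability _ (RGenOpens.measurableE R)).
move=> _ [_ [a [b ->] <-]]; rewrite setTI; apply: sub_sigma_algebra.
by apply: open_comp; [move=> x _; exact: cf|exact: interval_open].
Qed.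

(** * Trigonometric polynomials and Bernstein averages *)

Lemma continuous_sum (R : realType) (T : topologicalType) (I : Type)
    (s : seq I) (f : I -> T -> R) :
  (forall i, continuous (f i)) -> continuous (fun x => \sum_(i <- s) f i x).
Proof. by move=> cf; apply: continuous_big => //; exact: add_continuous. Qed.

Lemma continuous_dot (R : realType) n (a : 'cV[R]_n) :
  continuous (fun x : 'cV[R]_n => (a^T *m x) 0 0).
Proof.
have -> : (fun x : 'cV[R]_n => (a^T *m x) 0 0) = fun x => \sum_i a i 0 * x i 0.
  by apply/funext => x; rewrite mxE; apply: eq_bigr => i _; rewrite mxE.
apply: continuous_sum => i z.
exact: (cvgM (cvg_cst _) (@coord_continuous R n 1 i 0 z)).
Qed.

Section trigpoly.
Context (R : realType) (n : nat).
Implicit Types (f g : 'cV[R]_n -> R).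

(** The real parts of the linear combinations of characters of R^n: the class of
    functions whose integrals are controlled by characteristic functions. *)
Inductive trigpoly : ('cV[R]_n -> R) -> Prop :=
| trigpoly_cos (a : 'cV[R]_n) (theta : R) :
    trigpoly (fun x => cos (theta + (a^T *m x) 0 0))
| trigpoly_add f g : trigpoly f -> trigpoly g -> trigpoly (fun x => f x + g x)
| trigpoly_scale c f : trigpoly f -> trigpoly (fun x => c * f x).

Lemma trigpoly_cst c : trigpoly (fun=> c).
Proof.
have -> : (fun=> c) = (fun x : 'cV[R]_n => c * cos (0 + ((0 : 'cV[R]_n)^T *m x) 0 0)).
  by apply/funext => x; rewrite trmx0 mul0mx mxE addr0 cos0 mulr1.
by apply: trigpoly_scale; exact: trigpoly_cos.
Qed.

(** Product-to-sum formulas. *)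
Lemma trigpoly_mul f g : trigpoly f -> trigpoly g -> trigpoly (fun x => f x * g x).
Proof.
elim=> [a th|f1 f2 _ IH1 _ IH2|c f1 _ IH1] tg.
- elim: tg => [b et|g1 g2 _ IH1 _ IH2|c g1 _ IH1].
  + have -> : (fun x : 'cV[R]_n => cos (th + (a^T *m x) 0 0) * cos (et + (b^T *m x) 0 0)) =
      (fun x : 'cV[R]_n => 2^-1 * (cos ((th + et) + ((a + b)^T *m x) 0 0) +
                        cos ((th - et) + ((a - b)^T *m x) 0 0))).
      apply/funext => x.
      rewrite linearD linearB/= mulmxDl mulmxBl !mxE.
      move: (\sum_(j < n) _) (\sum_(j < n) _) => v u.
      have -> : th + et + (u + v) = (th + u) + (et + v) by ring.
      have -> : th - et + (u - v) = (th + u) - (et + v) by ring.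
      move: (th + u) (et + v) => p q.
      by rewrite !cosD sinN cosN; field.
    by apply: trigpoly_scale; apply: trigpoly_add; exact: trigpoly_cos.
  + under eq_fun do rewrite mulrDr; exact: trigpoly_add.
  + under eq_fun do rewrite mulrCA; exact: trigpoly_scale.
- under eq_fun do rewrite mulrDl; apply: trigpoly_add; [exact: IH1|exact: IH2].
- under eq_fun do rewrite -mulrA; apply: trigpoly_scale; exact: IH1.
Qed.

Lemma trigpoly_sin_coord (i : 'I_n) (l : R) : trigpoly (fun x => sin (l * x i 0)).
Proof.
have -> : (fun x : 'cV[R]_n => sin (l * x i 0)) =
    (fun x => cos (- (pi / 2) + ((l *: delta_mx i (0 : 'I_1))^T *m x) 0 0)).
  apply/funext => x.
  suff -> : ((l *: delta_mx i (0 : 'I_1))^T *m x) 0 0 = l * x i 0.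
    by rewrite addrC cosBpihalf.
  rewrite mxE (bigD1 i)//= big1 => [|j ji]; rewrite !mxE ?eqxx ?(negbTE ji)/=.
    by rewrite mulr1 addr0.
  by rewrite mulr0 mul0r.
exact: trigpoly_cos.
Qed.

Lemma trigpoly_continuous f : trigpoly f -> continuous f.
Proof.
elim=> [a th|f1 g1 _ cf _ cg|c f1 _ cf] x.
- have clin : continuous (fun x : 'cV[R]_n => th + (a^T *m x) 0 0).
    by move=> z; exact: (cvgD (cvg_cst th) (continuous_dot (a := a) (x := z))).
  by apply: continuous_comp; [exact: clin|exact: continuous_cos].
- exact: (cvgD (cf x) (cg x)).
- exact: (cvgM (cvg_cst c) (cf x)).
Qed.

Lemma trigpoly_bounded f : trigpoly f -> exists b, forall x, `|f x| <= b.
Proof.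
elim=> [a th|f1 g1 _ [b1 h1] _ [b2 h2]|c f1 _ [b h]].
- by exists 1 => x; exact: cos_max.
- by exists (b1 + b2) => x; rewrite (le_trans (ler_normD _ _))// lerD.
- by exists (`|c| * b) => x; rewrite normrM ler_wpM2l.
Qed.

End trigpoly.

Section bernstein.
Context (R : realType) (n : nat).
Implicit Types (t : 'I_n -> R) (J : 'I_n -> nat) (phi psi : ('I_n -> nat) -> R).

Definition bump_at (i : 'I_n) J : 'I_n -> nat := fun k => (J k + (k == i))%N.

(** Expectation of phi (J + N), where N counts, for each coordinate, the successes
    in independent trials: the list s names the coordinate of each trial and t i is
    the probability of success of a trial of coordinate i.  When s lists every
    coordinate m times this is the tensor-product Bernstein operator, and the
    recursion spares its binomial expansion. *)
Fixpoint bernstein t (s : seq 'I_n) phi J : R :=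
  if s is i :: s' then
    (1 - t i) * bernstein t s' phi J + t i * bernstein t s' phi (bump_at i J)
  else phi J.

Lemma bernstein_le t s phi psi J : (forall i, 0 <= t i <= 1) ->
  (forall J, phi J <= psi J) -> bernstein t s phi J <= bernstein t s psi J.
Proof.
move=> t01 pp; elim: s J => [|i s IH] J //=.
have /andP[t0 t1] := t01 i.
by rewrite lerD// ler_wpM2l// subr_ge0.
Qed.

Lemma bernstein_affine t s phi (a b : R) J :
  bernstein t s (fun J => a + b * phi J) J = a + b * bernstein t s phi J.
Proof. by elim: s J => [|i s IH] J //=; rewrite !IH; ring. Qed.

Lemma bernstein_abs_le t s phi b J : (forall i, 0 <= t i <= 1) ->
  (forall J, `|phi J| <= b) -> `|bernstein t s phi J| <= b.
Proof.
move=> t01 pb; elim: s J => [|i s IH] J //=.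
have /andP[t0 t1] := t01 i.
rewrite (le_trans (ler_normD _ _))// !normrM (ger0_norm t0) ger0_norm ?subr_ge0//.
have -> : b = (1 - t i) * b + t i * b by ring.
by rewrite lerD// ler_wpM2l// subr_ge0.
Qed.

(** The sum over the coordinates of variance plus squared bias, for a binomial
    variable with as many trials as s has occurrences of the coordinate. *)
Lemma bernstein_sqr t s (a : 'I_n -> R) J :
  bernstein t s (fun J => \sum_i ((J i)%:R - a i) ^+ 2) J =
  \sum_i ((count_mem i s)%:R * (t i * (1 - t i)) +
          ((J i)%:R + (count_mem i s)%:R * t i - a i) ^+ 2).
Proof.
elim: s J => [|k s IH] J /=.
  by apply: eq_bigr => i _; rewrite !mul0r add0r addr0.
rewrite !IH !mulr_sumr -big_split/=; apply: eq_bigr => i _.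
rewrite /bump_at eq_sym natrD [in RHS]natrD.
by case: eqVneq => [->|_] /=; ring.
Qed.

Lemma trigpoly_bernstein (t : 'cV[R]_n -> 'I_n -> R) s phi J :
  (forall i, trigpoly (fun x => t x i)) ->
  trigpoly (fun x => bernstein (t x) s phi J).
Proof.
move=> tt; elim: s J => [|i s IH] J /=; first exact: trigpoly_cst.
apply: trigpoly_add; apply: trigpoly_mul => //.
have -> : (fun x => 1 - t x i) = (fun x => 1 + (-1) * t x i).
  by apply/funext => x; rewrite mulN1r.
by apply: trigpoly_add; [exact: trigpoly_cst|exact: trigpoly_scale].
Qed.

End bernstein.

Lemma count_flatten_nseq (T : eqType) (s : seq T) m x :
  count_mem x (flatten (nseq m s)) = (m * count_mem x s)%N.
Proof. by elim: m => [|m IH] //=; rewrite count_cat IH mulSn. Qed.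

Section korovkin.
Context (R : realType) (n : nat).

(** The sines of the coordinates, scaled so that sin is injective on the range that
    is considered, separate the points of the box.  On the compact set of pairs with
    |f x - f y| >= e their squared distance has a positive minimum, and a large
    multiple of it exceeds 2 b. *)
Lemma korovkin_bound (f : 'cV[R]_n -> R) (L b e : R) :
  continuous f -> 0 < L -> (forall x, `|f x| <= b) -> 0 < e ->
  exists2 C : R, 0 <= C & forall x y : 'cV[R]_n,
    (forall i, `|x i 0| <= L * (pi / 2)) -> (forall i, `|y i 0| <= L * (pi / 2)) ->
    `|f x - f y| <= e + C * \sum_i (sin (x i 0 / L) - sin (y i 0 / L)) ^+ 2.
Proof.
move=> cf L0 fb e0.
pose D : set 'rV[R]_n := [set v | forall i, [set` `[- (L * (pi / 2)), L * (pi / 2)]] (v ord0 i)].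
have cD : compact D.
  apply: (@rV_compact _ _ (fun=> [set` `[- (L * (pi / 2)), L * (pi / 2)]])) => i.
  exact: segment_compact.
pose F (z : 'rV[R]_n * 'rV[R]_n) := `|f z.1^T - f z.2^T|.
have ctr : continuous (fun v : 'rV[R]_n => v^T).
  apply: continuous_mx => i j.
  have -> : (fun v : 'rV[R]_n => v^T i j) = (fun v => v j i).
    by apply/funext => v; rewrite mxE.
  exact: coord_continuous.
have cF : continuous F.
  move=> z; apply: cvg_norm; apply: cvgB.
    apply: (@continuous_comp _ _ _ fst (fun v : 'rV[R]_n => f v^T)); first exact: cvg_fst.
    by apply: (@continuous_comp _ _ _ (fun v : 'rV[R]_n => v^T) f); [exact: ctr|exact: cf].
  apply: (@continuous_comp _ _ _ snd (fun v : 'rV[R]_n => f v^T)); first exact: cvg_snd.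
  by apply: (@continuous_comp _ _ _ (fun v : 'rV[R]_n => v^T) f); [exact: ctr|exact: cf].
pose E := [set z | e <= F z] `&` (D `*` D).
have cE : compact E.
  rewrite /E setIC; apply: compact_closedI; first exact: compact_setX.
  rewrite (_ : [set z | _] = F @^-1` [set r | e <= r]) //.
  by apply: closed_comp; [move=> z _; exact: cF|exact: closed_ge].
pose psi (z : 'rV[R]_n * 'rV[R]_n) := \sum_i (sin (z.1 0 i / L) - sin (z.2 0 i / L)) ^+ 2.
have psi_ge0 z : 0 <= psi z by apply: sumr_ge0 => i _; exact: sqr_ge0.
have cpsi : continuous psi.
  apply: continuous_sum => i.
  have c1 : continuous (fun v : 'rV[R]_n => sin (v 0 i / L)).
    move=> v; apply: (@continuous_comp _ _ _ (fun v : 'rV[R]_n => v 0 i / L) (@sin R)).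
      exact: (cvgM (@coord_continuous R 1 n 0 i v) (cvg_cst _)).
    exact: continuous_sin.
  have c2 : continuous (fun z : 'rV[R]_n * 'rV[R]_n => sin (z.1 0 i / L) - sin (z.2 0 i / L)).
    move=> z; apply: cvgB.
      by apply: (@continuous_comp _ _ _ fst (fun v : 'rV[R]_n => sin (v 0 i / L)));
        [exact: cvg_fst|exact: c1].
    by apply: (@continuous_comp _ _ _ snd (fun v : 'rV[R]_n => sin (v 0 i / L)));
      [exact: cvg_snd|exact: c1].
  by move=> z; exact: (cvgM (c2 z) (c2 z)).
have inD (x : 'cV[R]_n) : (forall i, `|x i 0| <= L * (pi / 2)) -> D x^T.
  by move=> h i; rewrite mxE /= in_itv/= -ler_norml.
have b0 : 0 <= b by rewrite (le_trans _ (fb 0)).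
have [E0|Ene] := pselect (E !=set0); last first.
  exists 0 => // x y hx hy; rewrite mul0r addr0 leNgt; apply/negP => xy.
  apply: Ene; exists (x^T, y^T); split; last by split; exact: inD.
  by rewrite /F /= !trmxK ltW.
have [z /set_mem[Fz [Dz1 Dz2]] zmin] := compact_EVT_min E0 cE (continuous_subspaceT cpsi).
have psiz : 0 < psi z.
  rewrite lt_neqAle psi_ge0 andbT eq_sym; apply/eqP => /psumr_eq0P h.
  have z12 : z.1 = z.2.
    apply/rowP => i.
    have := h (fun i _ => sqr_ge0 _) i isT; move=> /eqP; rewrite sqrf_eq0 subr_eq0 => /eqP.
    have L1 : L != 0 by rewrite gt_eqF.
    have inL v : D v -> (v 0 i / L) \in `[- (pi / 2), pi / 2].
      move=> /(_ i); rewrite /= !in_itv/= => /andP[v1 v2].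
      by rewrite ler_pdivlMr// ler_pdivrMr// mulNr ![_ / 2 * L]mulrC v1 v2.
    move=> /(sin_inj (inL _ Dz1) (inL _ Dz2)).
    by move=> /(congr1 ( *%R^~ L)); rewrite !divfK.
  by move: Fz; rewrite /= /F z12 subrr normr0 leNgt e0.
exists (2 * b / psi z); first by rewrite divr_ge0// ?mulr_ge0// ltW.
move=> x y hx hy.
have [xye|exy] := leP `|f x - f y| e.
  apply: (le_trans xye); rewrite lerDl mulr_ge0 ?divr_ge0 ?mulr_ge0// ?(ltW psiz)//.
  by apply: sumr_ge0 => i _; exact: sqr_ge0.
have Exy : E (x^T, y^T).
  by split; [rewrite /= /F /= !trmxK ltW|split; exact: inD].
have := zmin _ (mem_set Exy); rewrite {2}/psi/=.
under eq_bigr do rewrite !mxE; set S := \sum_i _ => zS.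
apply: (@le_trans _ _ (2 * b)).
  by rewrite (le_trans (ler_normB _ _))// mulr2n mulrDl mul1r lerD.
rewrite -mulrA [_^-1 * _]mulrC mulrA.
apply: (@le_trans _ _ (2 * b * S / psi z)); last by rewrite lerDr ltW.
by rewrite -mulrA ler_peMr ?mulr_ge0// ler_pdivlMr// mul1r.
Qed.

End korovkin.

(** * Levy's continuity theorem *)

(** Korovkin's proof of the Weierstrass theorem in the variables
    t_i = (1 + sin (x_i / L)) / 2, which are trigonometric polynomials with values in
    [0, 1].  Bernstein averages are positive and preserve constants, so they keep the
    bound b everywhere on R^n, not only on the box; this is what makes
    the approximation usable against measures that are merely tight. *)
Lemma trigpoly_approx (R : realType) n (f : 'cV[R]_n -> R) (L b e : R) :
  continuous f -> 0 < L -> (forall x, `|f x| <= b) -> 0 < e ->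
  exists g, [/\ trigpoly g, forall x, `|g x| <= b &
    forall x : 'cV[R]_n, (forall i, `|x i 0| <= L) -> `|f x - g x| <= e].
Proof.
move=> cf L0 fb e0.
have e20 : 0 < e / 2 by rewrite divr_gt0.
have [C C0 fC] := korovkin_bound cf L0 fb e20.
have [m m0 mC] : exists2 m : nat, (0 < m)%N & 4 * C * n%:R * m%:R^-1 <= e / 2.
  exists (Num.truncn ((e / 2)^-1 * (4 * C * n%:R))).+1 => //.
  by rewrite ler_pdivrMr// -ler_pdivrMl// ltW// truncnS_gt.
pose t (x : 'cV[R]_n) i := 2^-1 * (1 + sin (L^-1 * x i 0)).
have t01 x i : 0 <= t x i <= 1.
  have := sin_max (L^-1 * x i 0); rewrite ler_norml => /andP[s1 s2].
  by rewrite /t; lra.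
pose u (J : 'I_n -> nat) i : R := Num.min 1 ((J i)%:R / m%:R).
have u01 J i : 0 <= u J i <= 1.
  by rewrite /u ge_min lexx/= le_min ler01 divr_ge0.
(* The point whose variables t_i are J i / m.  The minimum in u only matters
   for counts above m, which have probability 0. *)
pose node J : 'cV[R]_n := \col_i (L * asin (2 * u J i - 1)).
have nodeI J i : -1 <= 2 * u J i - 1 <= 1 by have := u01 J i; lra.
have node_in J i : `|node J i 0| <= L * (pi / 2).
  rewrite mxE normrM gtr0_norm// ler_pM2l// ler_norml.
  by rewrite asin_geNpi2// asin_lepi2.
have sin_node J i : sin (node J i 0 / L) = 2 * u J i - 1.
  rewrite mxE mulrC mulKf ?gt_eqF//.
  by apply: asinK; rewrite in_itv/= nodeI.
pose s := flatten (nseq m (enum 'I_n)).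
have cs i : count_mem i s = m.
  rewrite count_flatten_nseq (count_uniq_mem _ (enum_uniq _)) mem_enum muln1.
  by [].
pose g x := bernstein (t x) s (fun J => f (node J)) (fun=> 0%N).
exists g; split.
- apply: trigpoly_bernstein => i; apply: trigpoly_scale.
  by apply: trigpoly_add; [exact: trigpoly_cst|exact: trigpoly_sin_coord].
- by move=> x; apply: bernstein_abs_le => // J; exact: fb.
move=> x xL.
have x_in i : `|x i 0| <= L * (pi / 2).
  by rewrite (le_trans (xL i))// ler_peMr ?pihalf_ge1// ltW.
have m0' : 0 < m%:R :> R by rewrite ltr0n.
have key J : `|f x - f (node J)| <=
    e / 2 + 4 * C / m%:R ^+ 2 * \sum_i ((J i)%:R - m%:R * t x i) ^+ 2.
  apply: (le_trans (fC x (node J) x_in (node_in J))).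
  rewrite lerD2l -mulrA [4 * _]mulrC -!mulrA; apply: ler_wpM2l => //.
  rewrite !mulr_sumr; apply: ler_sum => i _.
  rewrite sin_node.
  have -> : sin (x i 0 / L) = 2 * t x i - 1.
    by rewrite /t mulVKf// [_^-1 * _]mulrC; ring.
  set ti := t x i; set ui := u J i.
  have -> : 2 * ti - 1 - (2 * ui - 1) = 2 * (ti - ui) by ring.
  have -> : 4 * ((m%:R ^+ 2)^-1 * ((J i)%:R - m%:R * ti) ^+ 2) =
     (2 * (ti - (J i)%:R / m%:R)) ^+ 2.
    by field; rewrite gt_eqF.
  rewrite !exprMn ler_pM2l ?exprn_gt0//.
  have /andP[ti0 ti1] : 0 <= ti <= 1 by exact: t01.
  rewrite /ui /u; set v := _ / _.
  have [v1|v1] := leP 1 v; last by [].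
  by rewrite -[leRHS]sqrrN -[leLHS]sqrrN lerXn2r ?nnegrE; lra.
have /andP[k1 k2] :
    - (e / 2 + 4 * C / m%:R ^+ 2 * bernstein (t x) s
        (fun J => \sum_i ((J i)%:R - m%:R * t x i) ^+ 2) (fun=> 0%N))
    <= f x - g x <=
    e / 2 + 4 * C / m%:R ^+ 2 * bernstein (t x) s
        (fun J => \sum_i ((J i)%:R - m%:R * t x i) ^+ 2) (fun=> 0%N).
  have -> : f x - g x = bernstein (t x) s (fun J => f x + (-1) * f (node J)) (fun=> 0%N).
    by rewrite bernstein_affine mulN1r.
  apply/andP; split.
    rewrite opprD -(mulNr (4 * C / m%:R ^+ 2)) -bernstein_affine; apply: bernstein_le => // J.
    by have := key J; rewrite ler_norml => /andP[]; lra.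
  rewrite -bernstein_affine; apply: bernstein_le => // J.
  by have := key J; rewrite ler_norml => /andP[]; lra.
rewrite bernstein_sqr in k1 k2.
have S : \sum_i ((count_mem i s)%:R * (t x i * (1 - t x i)) +
          (0%:R + (count_mem i s)%:R * t x i - m%:R * t x i) ^+ 2) <= n%:R * m%:R.
  apply: (@le_trans _ _ (\sum_(i < n) m%:R)).
    apply: ler_sum => i _; rewrite cs add0r subrr expr0n addr0 ler_piMr//.
    by have /andP[a1 a2] := t01 x i; nra.
  by rewrite sumr_const card_ord -[_ *+ n]mulr_natl.
have B : 4 * C / m%:R ^+ 2 * \sum_i ((count_mem i s)%:R * (t x i * (1 - t x i)) +
          (0%:R + (count_mem i s)%:R * t x i - m%:R * t x i) ^+ 2) <= e / 2.
  apply: (le_trans _ mC).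
  apply: (@le_trans _ _ (4 * C / m%:R ^+ 2 * (n%:R * m%:R))).
    by apply: ler_wpM2l => //; rewrite divr_ge0 ?mulr_ge0 ?exprn_ge0.
  by rewrite le_eqVlt; apply/orP; left; apply/eqP; field; rewrite gt_eqF.
by rewrite ler_norml; move: B k1 k2; set Z := _ * \sum_i _; lra.
Qed.

Section outside_box.
Context d (T : measurableType d) (R : realType) (P : probability T R) (n : nat)
  (X : T -> 'cV[R]_n).
Hypothesis mX : forall i, measurable_fun setT (fun w => X w i 0).

Definition outside_box (L : R) : set T := [set w | exists i, L < `|X w i 0|].

Lemma measurable_outside_box L : measurable (outside_box L).
Proof.
have -> : outside_box L = \bigcup_(i in [set: 'I_n]) [set w | L < `|X w i 0|].
  by apply/seteqP; split => [w [i wi]|w [i _ wi]]; exists i.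
apply: fin_bigcup_measurable => // i _.
rewrite (_ : [set w | _] = setT `&` (fun w => `|X w i 0|) @^-1` `]L, +oo[).
  have m1 : measurable_fun setT (fun w => `|X w i 0|) by exact: measurableT_comp.
  by apply: m1 => //; exact: measurable_itv.
by rewrite setTI; apply/seteqP; split=> w /=; rewrite in_itv/= andbT.
Qed.

(** The complements of the growing boxes decrease to the empty set. *)
Lemma outside_box_small (e : R) : 0 < e ->
  exists2 L, 0 < L & (P (outside_box L) <= e%:E)%E.
Proof.
move=> e0.
have h : P (outside_box k.+1%:R) @[k --> \oo] --> P (\bigcap_k outside_box k.+1%:R).
  apply: nonincreasing_cvg_mu.
  - by rewrite (le_lt_trans (probability_le1 _ (measurable_outside_box _)))// ltry.
  - by move=> k; exact: measurable_outside_box.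
  - by apply: bigcapT_measurable => k; exact: measurable_outside_box.
  - move=> k l kl; apply/subsetPset => w [i wi]; exists i.
    by rewrite (le_lt_trans _ wi)// ler_nat.
have cap0 : \bigcap_k outside_box k.+1%:R = set0.
  apply/seteqP; split => // w h0.
  pose M := \sum_i `|X w i 0|.
  have [i] := h0 (Num.truncn M) I.
  apply/negP; rewrite -leNgt; apply: ltW.
  apply: (@le_lt_trans _ _ M); last by rewrite truncnS_gt.
  by rewrite /M (bigD1 i)//= lerDl sumr_ge0.
rewrite cap0 measure0 in h.
have e0' : (0 < e%:E)%E by rewrite lte_fin.
have /fine_cvgP[_ /cvgr0Pnorm_lt/(_ _ e0)[k _ hk]] := h.
exists k.+1%:R => //.
have := hk k (leqnn k); rewrite /= ger0_norm ?fine_ge0// => hl.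
by move: (ltW hl); rewrite -lee_fin fineK// fin_num_measure//; exact: measurable_outside_box.
Qed.

Lemma Rintegral_dist_outside_box (f g : 'cV[R]_n -> R) (b e e' L : R) :
  continuous f -> continuous g ->
  (forall x, `|f x| <= b) -> (forall x, `|g x| <= b) -> 0 <= e ->
  (forall x : 'cV[R]_n, (forall i, `|x i 0| <= L) -> `|f x - g x| <= e) ->
  (P (outside_box L) <= e'%:E)%E ->
  `|\int[P]_w f (X w) - \int[P]_w g (X w)| <= e + 2 * b * e'.
Proof.
move=> cf cg fb gb e0 fg out.
have b0 : 0 <= b by rewrite (le_trans _ (fb 0)).
have mf : measurable_fun setT (fun w => f (X w)).
  exact: (measurableT_comp (continuous_measurable_borel cf) (measurable_fun_borel_cV mX)).
have mg : measurable_fun setT (fun w => g (X w)).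
  exact: (measurableT_comp (continuous_measurable_borel cg) (measurable_fun_borel_cV mX)).
have mO := measurable_outside_box L.
have iO : P.-integrable setT (EFin \o (\1_(outside_box L) : T -> R)).
  apply: (@integrable_bounded _ _ _ _ _ 1); first exact: measurable_indic.
  by move=> w; rewrite indicE; case: (_ \in _); rewrite ?normr1 ?normr0.
have i1 : P.-integrable setT (EFin \o (fun=> e)).
  by apply: (@integrable_bounded _ _ _ _ _ `|e|).
have i2 : P.-integrable setT (EFin \o (fun w => 2 * b * \1_(outside_box L) w)).
  by have := integrableZl measurableT (2 * b) iO; apply: eq_integrable.
have i3 : P.-integrable setT (EFin \o (fun w => e + 2 * b * \1_(outside_box L) w)).
  by have := integrableD measurableT i1 i2; apply: eq_integrable.
apply: (@le_trans _ _ (\int[P]_w (e + 2 * b * \1_(outside_box L) w))).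
  apply: Rintegral_dist_le => //.
  - by apply: (@integrable_bounded _ _ _ _ _ b).
  - by apply: (@integrable_bounded _ _ _ _ _ b).
  - move=> w; rewrite indicE; have [wO|wO] := boolP (w \in _).
      rewrite mulr1; apply: (le_trans (ler_normB _ _)).
      by have := fb (X w); have := gb (X w); lra.
    rewrite mulr0 addr0; apply: fg => i; rewrite leNgt; apply/negP => iL.
    by move/negP: wO; apply; apply/mem_set; exists i.
rewrite RintegralD// RintegralZl// Rintegral_cst_probability lerD2l.
rewrite ler_wpM2l ?mulr_ge0// -lee_fin /Rintegral integral_indic// setIT.
by rewrite fineK// fin_num_measure.
Qed.

End outside_box.

(** Convergence of characteristic functions is convergence of the integrals of all
    trigonometric polynomials.  A bounded continuous f is close to such a
    polynomial g on a large box; outside of the box, where both are bounded by b,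
    tightness bounds the error. *)
Theorem levy_continuity (R : realType) n
    d (T : measurableType d) (P : probability T R) (X : nat -> T -> 'cV[R]_n)
    d' (T' : measurableType d') (P' : probability T' R) (X' : T' -> 'cV[R]_n)
    (f : 'cV[R]_n -> R) :
  (forall K i, measurable_fun setT (fun w => X K w i 0)) ->
  (forall i, measurable_fun setT (fun w => X' w i 0)) ->
  (forall (a : 'cV[R]_n) (theta : R),
    \int[P]_w cos (theta + (a^T *m X K w) 0 0) @[K --> \oo] -->
    \int[P']_w cos (theta + (a^T *m X' w) 0 0)) ->
  (forall e : R, 0 < e -> exists2 L, 0 < L &
    \forall K \near \oo, (P (outside_box (X K) L) <= e%:E)%E) ->
  continuous f -> (exists b, forall x, `|f x| <= b) ->
  \int[P]_w f (X K w) @[K --> \oo] --> \int[P']_w f (X' w).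
Proof.
move=> mX mX' charX tight cf [b fb].
have mcomp (g : 'cV[R]_n -> R) dd (U : measurableType dd) (Y : U -> 'cV[R]_n) :
    continuous g -> (forall i, measurable_fun setT (fun w => Y w i 0)) ->
    measurable_fun setT (fun w => g (Y w)).
  move=> cg mY.
  exact: (measurableT_comp (continuous_measurable_borel cg) (measurable_fun_borel_cV mY)).
have trig g : trigpoly g -> \int[P]_w g (X K w) @[K --> \oo] --> \int[P']_w g (X' w).
  elim => [a th|f1 f2 t1 IH1 t2 IH2|c f1 t1 IH1]; first exact: charX.
  - have [b1 fb1] := trigpoly_bounded t1; have [b2 fb2] := trigpoly_bounded t2.
    have c1 := trigpoly_continuous t1; have c2 := trigpoly_continuous t2.
    rewrite RintegralD//; last 2 first.
    + by apply: (@integrable_bounded _ _ _ _ _ b1) => //; exact: mcomp.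
    + by apply: (@integrable_bounded _ _ _ _ _ b2) => //; exact: mcomp.
    have -> : (fun K => \int[P]_w (f1 (X K w) + f2 (X K w))) =
        (fun K => \int[P]_w f1 (X K w) + \int[P]_w f2 (X K w)).
      apply/funext => K; rewrite RintegralD//.
      + by apply: (@integrable_bounded _ _ _ _ _ b1) => //; exact: mcomp.
      + by apply: (@integrable_bounded _ _ _ _ _ b2) => //; exact: mcomp.
    exact: cvgD.
  - have [b1 fb1] := trigpoly_bounded t1.
    have c1 := trigpoly_continuous t1.
    rewrite RintegralZl//; last first.
      by apply: (@integrable_bounded _ _ _ _ _ b1) => //; exact: mcomp.
    have -> : (fun K => \int[P]_w (c * f1 (X K w))) =
        (fun K => c * \int[P]_w f1 (X K w)).
      apply/funext => K; rewrite RintegralZl//.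
      by apply: (@integrable_bounded _ _ _ _ _ b1) => //; exact: mcomp.
    by apply: cvgM => //; exact: cvg_cst.
apply/cvgrPdist_lt => e e0.
have b0 : 0 <= b by rewrite (le_trans _ (fb 0)).
pose e1 := e / 6; have e10 : 0 < e1 by rewrite divr_gt0.
pose e2 := e / (12 * (b + 1)); have e20 : 0 < e2.
  by rewrite divr_gt0// mulr_gt0// ltr_wpDl.
have be2 : 2 * b * e2 <= e1.
  rewrite /e2 mulrA ler_pdivrMr; last by rewrite mulr_gt0// ltr_wpDl.
  by rewrite /e1; nra.
have [L1 L10 tX] := tight _ e20.
have [L2 L20 tX'] := outside_box_small P' mX' e20.
pose L := Num.max L1 L2.
have L0 : 0 < L by rewrite lt_max L10.
have [g [tg gb fg]] := trigpoly_approx cf L0 fb e10.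
have cg := trigpoly_continuous tg.
have mono dd (U : measurableType dd) (Q : probability U R) (Y : U -> 'cV[R]_n) M :
    (forall i, measurable_fun setT (fun w => Y w i 0)) -> M <= L ->
    (Q (outside_box Y M) <= e2%:E)%E -> (Q (outside_box Y L) <= e2%:E)%E.
  move=> mY ML; apply: le_trans; apply: le_measure; rewrite ?inE;
    [exact: measurable_outside_box|exact: measurable_outside_box|].
  by move=> w [i wi]; exists i; exact: le_lt_trans wi.
have L1L : L1 <= L by rewrite le_max lexx.
have L2L : L2 <= L by rewrite le_max lexx orbT.
have d2 := Rintegral_dist_outside_box mX' cf cg fb gb (ltW e10) fg
  (mono _ _ _ _ _ mX' L2L tX').
have /cvgrPdist_lt/(_ _ e10) := trig g tg.
move=> h; near=> K.
have tK : (P (outside_box (X K) L1) <= e2%:E)%E by near: K.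
have d1 := Rintegral_dist_outside_box (mX K) cf cg fb gb (ltW e10) fg
  (mono _ _ _ _ _ (mX K) L1L tK).
have d3 : `|\int[P']_w g (X' w) - \int[P]_w g (X K w)| < e1 by near: K.
move: d1 d2 d3; move: (\int[P]_w g (X K w)) (\int[P]_w f (X K w))
  (\int[P']_w g (X' w)) (\int[P']_w f (X' w)) => p q r s.
rewrite !ler_norml !ltr_norml => /andP[? ?] /andP[? ?] /andP[? ?].
have e6 : e = 6 * e1 by rewrite /e1; field.
by apply/andP; split; lra.
Unshelve. all: by end_near.
Qed.

(** * Laws on the line are determined by characteristic functions *)

Section itv_approx.
Context (R : realType) (a b : R).

(** Bounded continuous functions that increase to the indicator of the open
    interval with endpoints a and b. *)
Definition itv_approx (k : nat) (x : R) : R :=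
  Num.min 1 (k%:R * Num.max 0 (Num.min (x - a) (b - x))).

Lemma itv_approx_ge0 k x : 0 <= itv_approx k x.
Proof. by rewrite le_min ler01 mulr_ge0// le_max lexx. Qed.

Lemma itv_approx_le1 k x : `|itv_approx k x| <= 1.
Proof. by rewrite ger0_norm ?itv_approx_ge0// ge_min lexx. Qed.

Lemma itv_approx_continuous k : continuous (itv_approx k).
Proof.
have c1 : continuous (fun x : R => x - a).
  by move=> x; apply: cvgB; [exact: cvg_id|exact: cvg_cst].
have c2 : continuous (fun x : R => b - x).
  by move=> x; apply: cvgB; [exact: cvg_cst|exact: cvg_id].
pose q (x : R) := ((x - a) + (b - x) - `|(x - a) - (b - x)|) / 2.
have cq : continuous q.
  move=> x; apply: cvgM; last exact: cvg_cst.
  apply: cvgB; first by apply: cvgD; [exact: c1|exact: c2].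
  by apply: cvg_norm; apply: cvgB; [exact: c1|exact: c2].
pose u (x : R) := k%:R * ((0 + q x + `|0 - q x|) / 2).
have cu : continuous u.
  move=> x; apply: cvgM; first exact: cvg_cst.
  apply: cvgM; last exact: cvg_cst.
  apply: cvgD; first by apply: cvgD; [exact: cvg_cst|exact: cq].
  by apply: cvg_norm; apply: cvgB; [exact: cvg_cst|exact: cq].
have -> : itv_approx k = fun x => (1 + u x - `|1 - u x|) / 2.
  by apply/funext => x; rewrite /itv_approx !minr_absE maxr_absE.
move=> x; apply: cvgM; last exact: cvg_cst.
apply: cvgB; first by apply: cvgD; [exact: cvg_cst|exact: cu].
by apply: cvg_norm; apply: cvgB; [exact: cvg_cst|exact: cu].
Qed.

Lemma itv_approx_cvg x : itv_approx k x @[k --> \oo] --> (\1_`]a, b[ x : R).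
Proof.
rewrite indicE; have [|] := boolP (x \in `]a, b[%classic).
  rewrite inE/= in_itv/= => /andP[ax xb].
  have q0 : 0 < Num.min (x - a) (b - x) by rewrite lt_min !subr_gt0 ax.
  apply: cvg_near_cst; near=> k.
  rewrite /itv_approx max_r ?ltW// min_l// -ler_pdivrMr// mul1r.
  by near: k; exact: nbhs_infty_ger.
rewrite notin_setE/= in_itv/= => /negP xab.
have q0 : Num.min (x - a) (b - x) <= 0.
  by rewrite ge_min !subr_le0; move: xab; rewrite negb_and -!leNgt.
by apply: cvg_near_cst; apply: nearW => k; rewrite /itv_approx max_l// mulr0 min_r.
Unshelve. all: by end_near.
Qed.

End itv_approx.

(** Levy's theorem for the constant sequence with value X gives equal
    integrals for bounded continuous functions, hence equal probabilities for open
    intervals, which form a pi-system generating the Borel sets. *)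
Theorem charfun_unique (R : realType)
    d (T : measurableType d) (P : probability T R) (X : T -> R)
    d' (T' : measurableType d') (P' : probability T' R) (X' : T' -> R) :
  measurable_fun setT X -> measurable_fun setT X' ->
  (forall t theta : R, \int[P]_w cos (theta + t * X w) =
                       \int[P']_w cos (theta + t * X' w)) ->
  forall B : set R, measurable B -> P (X @^-1` B) = P' (X' @^-1` B).
Proof.
move=> mX mX' XX'.
have int_eq (f : R -> R) : continuous f -> (forall x, `|f x| <= 1) ->
    \int[P]_w f (X w) = \int[P']_w f (X' w).
  move=> cf f1.
  (* The line is R^1, where the continuity theorem applies. *)
  pose V w : 'cV[R]_1 := const_mx (X w); pose V' w : 'cV[R]_1 := const_mx (X' w).
  pose F (v : 'cV[R]_1) := f (v 0 0).
  have VE : (fun w => F (V w)) = (fun w => f (X w)).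
    by apply/funext => w; rewrite /F mxE.
  have VE' : (fun w => F (V' w)) = (fun w => f (X' w)).
    by apply/funext => w; rewrite /F mxE.
  have mV i : measurable_fun setT (fun w => V w i 0) by under eq_fun do rewrite mxE.
  have mV' i : measurable_fun setT (fun w => V' w i 0) by under eq_fun do rewrite mxE.
  have aV (a : 'cV[R]_1) w : (a^T *m V w) 0 0 = a 0 0 * X w.
    by rewrite mxE big_ord1 !mxE.
  have aV' (a : 'cV[R]_1) w : (a^T *m V' w) 0 0 = a 0 0 * X' w.
    by rewrite mxE big_ord1 !mxE.
  have := @levy_continuity R 1 _ _ P (fun=> V) _ _ P' V' F (fun=> mV) mV'.
  rewrite VE'.
  have -> : (fun _ : nat => \int[P]_w F (V w)) = (fun _ : nat => \int[P]_w f (X w)).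
    by apply/funext => _; rewrite VE.
  move=> h.
  suff lim : (fun _ : nat => \int[P]_w f (X w)) @ \oo --> \int[P']_w f (X' w).
    exact: (cvg_unique (@Rhausdorff R) (cvg_cst _) lim).
  apply: h.
  - move=> a theta.
    under eq_fun do under eq_Rintegral do rewrite aV.
    by under eq_Rintegral do rewrite aV'; rewrite XX'; exact: cvg_cst.
  - move=> e e0; have [L L0 hL] := outside_box_small P mV e0.
    by exists L => //; apply: nearW.
  - move=> v; apply: (@continuous_comp _ _ _ (fun v : 'cV[R]_1 => v 0 0) f).
      exact: coord_continuous.
    exact: cf.
  - by exists 1 => v; exact: f1.
pose X1 : {mfun T >-> R} := mfun_Sub (mem_set mX).
pose X1' : {mfun T' >-> R} := mfun_Sub (mem_set mX').
have int_cvg dd (U : measurableType dd) (Q : probability U R) (Y : U -> R) a b :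
    measurable_fun setT Y ->
    (\int[Q]_w (itv_approx a b k (Y w)) @[k --> \oo] --> fine (Q (Y @^-1` `]a, b[))).
  move=> mY.
  have mk k : measurable_fun setT (fun w => (itv_approx a b k (Y w))%:E).
    apply/measurable_EFinP; apply: measurableT_comp mY.
    by apply: continuous_measurable_fun; exact: itv_approx_continuous.
  have mYab : measurable (Y @^-1` `]a, b[).
    by rewrite -[X in measurable X]setTI; apply: mY => //; exact: measurable_itv.
  have m1 : measurable_fun setT (EFin \o (\1_(Y @^-1` `]a, b[) : U -> R)).
    by apply/measurable_EFinP; exact: measurable_indic.
  have lim : (\int[Q]_w (itv_approx a b k (Y w))%:E @[k --> \oo] -->
      \int[Q]_w (\1_(Y @^-1` `]a, b[) w)%:E)%E.
    case: (@dominated_convergence _ _ _ Q setT measurableT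
      (fun k w => (itv_approx a b k (Y w))%:E)
      (EFin \o (\1_(Y @^-1` `]a, b[) : U -> R)) (cst 1%E)) => //.
    - apply: aeW => w _; apply: cvg_EFin; first exact: nearW.
      have := @itv_approx_cvg R a b (Y w); rewrite !indicE.
      by have -> : (w \in Y @^-1` `]a, b[) = (Y w \in `]a, b[%classic)
        by apply/idP/idP; rewrite !inE.
    - have := @integrable_bounded _ _ _ Q (fun=> 1) 1 (@measurable_cst _ _ _ _ setT (1 : R)).
      by move=> h; apply: h => w; rewrite normr1.
    - by apply: aeW => w k _; rewrite /= lee_fin itv_approx_le1.
  rewrite integral_indic// setIT in lim.
  by apply/fine_cvg; rewrite fineK// fin_num_measure.
move=> B mB.
suff : distribution P X1 B = distribution P' X1' B by [].
apply: (measure_unique (@RGenOpens.G R) (fun k => [set` `]- k%:R, k%:R[])) => //.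
- exact: RGenOpens.measurableE.
- move=> _ _ [a [b ->]] [c [e ->]]; exists (Num.max a c), (Num.min b e).
  apply/seteqP; split => x /=; rewrite !in_itv/= gt_max lt_min.
    by move=> [/andP[-> ->] /andP[-> ->]].
  by move=> /andP[/andP[-> ->] /andP[-> ->]].
- by move=> k; exists (- k%:R), k%:R.
- apply/seteqP; split => // x _; exists (Num.truncn `|x|).+1 => //=.
  by rewrite in_itv/= -ltr_norml truncnS_gt.
- move=> _ [a [b ->]]; rewrite /distribution /pushforward/=.
  have h := int_cvg _ _ P X a b mX; have h' := int_cvg _ _ P' X' a b mX'.
  have mXab : measurable (X @^-1` `]a, b[).
    by rewrite -[X in measurable X]setTI; apply: (mX) => //; exact: measurable_itv.
  have mXab' : measurable (X' @^-1` `]a, b[).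
    by rewrite -[X in measurable X]setTI; apply: (mX') => //; exact: measurable_itv.
  rewrite -[LHS]fineK ?fin_num_measure// -[RHS]fineK ?fin_num_measure//; congr EFin.
  apply: (cvg_unique _ h) => //.
  have -> : (fun k => \int[P]_w itv_approx a b k (X w)) =
      (fun k => \int[P']_w itv_approx a b k (X' w)).
    by apply/funext => k; apply: int_eq; [exact: itv_approx_continuous|exact: itv_approx_le1].
  exact: h'.
- by move=> k; exact: le_lt_trans (probability_le1 _ (measurable_itv _)) (ltry _).
Qed.

(** * Gaussian vectors *)

Lemma measurable_cos_affine d (T : measurableType d) (R : realType) (theta : R) (Y : T -> R) :
  measurable_fun setT Y -> measurable_fun setT (fun w => cos (theta + Y w)).
Proof.
move=> mY; apply: measurableT_comp; last exact: measurable_funD.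
by apply: continuous_measurable_fun => x; exact: continuous_cos.
Qed.

Lemma measurable_dot (R : realType) n (a : 'cV[R]_n) :
  measurable_fun setT ((fun x : 'cV[R]_n => (a^T *m x) 0 0) : borel 'cV[R]_n -> R).
Proof. by apply: continuous_measurable_borel; exact: continuous_dot. Qed.

Lemma charfun_normal_prob (R : realType) (s : R) (theta t : R) : s != 0 ->
  \int[normal_prob 0 s]_x cos (theta + t * x) =
  expR (- (s ^+ 2 * t ^+ 2 / 2)) * cos theta.
Proof.
move=> s0; rewrite -(charfun_normal_pdf s0).
have mc : measurable_fun setT (fun x : R => cos (theta + t * x)).
  by apply: measurable_cos_affine; exact: mulrl_measurable.
rewrite /Rintegral; congr fine.
rewrite (@integral_normal_prob R 0 s (fun x => (cos (theta + t * x))%:E)).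
- by apply: eq_integral => x _; rewrite EFinM.
- exact/measurable_EFinP.
- have := @integrable_bounded _ _ _ (normal_prob 0 s : probability (measurableTypeR R) R) _ 1 mc.
  by move=> /(_ (fun x => cos_max _))/integrableP[].
Qed.

(** The law of the sum over b in s of xi_b * b, with independent standard normal
    xi_b.  Each step of the induction takes the product with a standard normal
    law on the line and pushes it forward along (x, t) |-> x + t b. *)
Theorem gaussian_vector_exists (R : realType) n (s : seq 'cV[R]_n) :
  exists mu : probability (borel 'cV[R]_n) R, forall (a : 'cV[R]_n) (theta : R),
    \int[mu]_x cos (theta + (a^T *m (x : 'cV[R]_n)) 0 0) =
    expR (- ((\sum_(b <- s) ((a^T *m b) 0 0) ^+ 2) / 2)) * cos theta.
Proof.
have ml := @measurable_dot R n.
elim: s => [|b s [mu hmu]].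
  exists (@dirac _ (borel 'cV[R]_n) 0 R) => a theta.
  rewrite /Rintegral integral_dirac//; last first.
    by apply/measurable_EFinP; exact: measurable_cos_affine.
  by rewrite diracE in_setT mul1e/= mulmx0 mxE addr0 big_nil mul0r oppr0 expR0 mul1r.
pose nu : probability (measurableTypeR R) R := normal_prob 0 1.
pose phi (z : borel 'cV[R]_n * measurableTypeR R) : 'cV[R]_n := (z.1 : 'cV[R]_n) + z.2 *: b.
have mphi : measurable_fun setT (phi : _ -> borel 'cV[R]_n).
  apply: measurable_fun_borel_cV => i.
  have -> : (fun z => phi z i 0) = fun z => (z.1 : 'cV[R]_n) i 0 + z.2 * b i 0.
    by apply/funext => z; rewrite !mxE.
  apply: measurable_funD.
    apply: (@measurableT_comp _ _ _ _ _ _ ((fun x : 'cV[R]_n => x i 0) : borel 'cV[R]_n -> R) _ fst) => //.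
    by apply: continuous_measurable_borel; exact: coord_continuous.
  by apply: measurable_funM => //; exact: measurable_snd.
pose Phi := mfun_Sub (mem_set mphi) :
  {mfun (borel 'cV[R]_n * measurableTypeR R)%type >-> borel 'cV[R]_n}.
exists (distribution (mu \x nu)%E Phi) => a theta.
have mcos : measurable_fun setT
   ((fun x : 'cV[R]_n => cos (theta + (a^T *m x) 0 0)) : borel 'cV[R]_n -> R).
  exact: measurable_cos_affine.
have icos : (mu \x nu)%E.-integrable setT
   (EFin \o (fun z => cos (theta + (a^T *m phi z) 0 0))).
  apply: (@integrable_bounded _ _ _ (mu \x nu)%E _ 1) => [|z]; last exact: cos_max.
  exact: (measurableT_comp mcos mphi).
rewrite /Rintegral integral_distribution//; last exact/measurable_EFinP.
rewrite -integral12_prod_meas1//.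
have -> : (fun x => fubini_F nu (EFin \o (fun z => cos (theta + (a^T *m phi z) 0 0))) x) =
    fun x => (expR (- (((a^T *m b) 0 0) ^+ 2 / 2)) * cos (theta + (a^T *m (x : 'cV[R]_n)) 0 0))%:E.
  apply/funext => x; rewrite /fubini_F.
  have := @charfun_normal_prob R 1 (theta + (a^T *m (x : 'cV[R]_n)) 0 0)
    ((a^T *m b) 0 0) (oner_neq0 _).
  rewrite expr1n mul1r => <-; rewrite /Rintegral fineK.
    apply: eq_integral => t _; rewrite /phi/= mulmxDr -scalemxAr !mxE.
    by rewrite addrA [t * _]mulrC.
  apply: integrable_fin_num => //.
  apply: (@integrable_bounded _ _ _ nu _ 1) => [|z]; last exact: cos_max.
  by apply: measurable_cos_affine; exact: mulrl_measurable.
rewrite -/(Rintegral mu setT _) RintegralZl//; last first.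
  by apply: (@integrable_bounded _ _ _ mu _ 1) => // z; exact: cos_max.
rewrite hmu big_cons mulrA -expRD; congr (expR _ * _).
by rewrite mulrDl opprD.
Qed.

(** The law of a linear functional <a, x> has the characteristic function of the
    centered normal law of variance a^T S a, which determines it. *)
Theorem multinormal_of_charfun (R : realType) n (S : 'M[R]_n)
    (mu : probability (borel 'cV[R]_n) R) :
  (forall a : 'cV[R]_n, 0 <= (a^T *m S *m a) 0 0) ->
  (forall (a : 'cV[R]_n) (theta : R),
    \int[mu]_x cos (theta + (a^T *m (x : 'cV[R]_n)) 0 0) =
    expR (- ((a^T *m S *m a) 0 0 / 2)) * cos theta) ->
  is_multinormal 0 S mu.
Proof.
move=> S0 hmu a B mB; rewrite mulmx0 mxE.
set v := (a^T *m S *m a) 0 0.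
have v0 : 0 <= v := S0 a.
have ml := @measurable_dot R n a.
have hv t theta : \int[mu]_x cos (theta + t * (a^T *m (x : 'cV[R]_n)) 0 0) =
    expR (- (v * t ^+ 2 / 2)) * cos theta.
  have tE (x : 'cV[R]_n) : t * (a^T *m x) 0 0 = ((t *: a)^T *m x) 0 0.
    by rewrite [(t *: a)^T]linearZ/= -scalemxAl [RHS]mxE.
  under eq_Rintegral do rewrite tE.
  rewrite hmu; congr (expR (- (_ / 2)) * _).
  by rewrite [(t *: a)^T]linearZ/= -!scalemxAl -scalemxAr scalerA [LHS]mxE -/v mulrC expr2.
rewrite /normal1; have [vE0|vN0] := eqVneq v 0.
  have := @charfun_unique R _ _ mu _ _ _ (@dirac _ (measurableTypeR R) 0 R) id ml
    (@measurable_id _ _ _) _ B mB.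
  apply=> t theta; rewrite hv vE0 mul0r mul0r oppr0 expR0 mul1r.
  rewrite /Rintegral integral_dirac//; last first.
    by apply/measurable_EFinP; apply: measurable_cos_affine; exact: mulrl_measurable.
  by rewrite diracE in_setT mul1e/= mulr0 addr0.
have := @charfun_unique R _ _ mu _ _ _ (normal_prob 0 (Num.sqrt v) : probability (measurableTypeR R) R) id ml
    (@measurable_id _ _ _) _ B mB.
apply=> t theta; rewrite hv charfun_normal_prob ?sqr_sqrtr//.
by rewrite gt_eqF// sqrtr_gt0 lt_neqAle eq_sym vN0.
Qed.

(** * Positive semidefinite forms *)

Section bilinear_form.
Context (R : realType) (n : nat).
Implicit Types (S : 'M[R]_n) (a b x : 'cV[R]_n).

Definition form S a b : R := (a^T *m S *m b) 0 0.

Lemma formDl S a b x : form S (a + b) x = form S a x + form S b x.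
Proof. by rewrite /form [(a + b)^T]linearD/= !mulmxDl [LHS]mxE. Qed.

Lemma formDr S a b x : form S x (a + b) = form S x a + form S x b.
Proof. by rewrite /form mulmxDr [LHS]mxE. Qed.

Lemma formZl S (t : R) a x : form S (t *: a) x = t * form S a x.
Proof. by rewrite /form [(t *: a)^T]linearZ/= -!scalemxAl [LHS]mxE. Qed.

Lemma formZr S (t : R) a x : form S x (t *: a) = t * form S x a.
Proof. by rewrite /form -scalemxAr [LHS]mxE. Qed.

Lemma formC S a b : S^T = S -> form S a b = form S b a.
Proof.
move=> Ssym; rewrite /form -[LHS]mulr1.
have -> : (a^T *m S *m b) 0 0 = ((a^T *m S *m b)^T) 0 0 by rewrite [RHS]mxE.
by rewrite !trmx_mul trmxK Ssym mulmxA mulr1.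
Qed.

Lemma form_delta S i a : form S (delta_mx i 0) a = (S *m a) i 0.
Proof.
by rewrite /form -mulmxA trmx_delta -rowE mxE.
Qed.

Lemma form_delta2 S i j : form S (delta_mx i 0) (delta_mx j 0) = S i j.
Proof. by rewrite form_delta -colE mxE. Qed.

(** Otherwise e_j + t e_i, with t a suitable multiple of - 1 / S i j, would make the
    form negative. *)
Lemma psd_row0 S i j : S^T = S -> (forall a, 0 <= form S a a) ->
  S i i = 0 -> S i j = 0.
Proof.
move=> Ssym Spsd Sii; set ei : 'cV[R]_n := delta_mx i 0.
set ej : 'cV[R]_n := delta_mx j 0.
have h t : 0 <= S j j + 2 * t * S i j.
  have := Spsd (ej + t *: ei).
  rewrite !formDl !formDr !formZl !formZr !form_delta2 Sii.
  have -> : S j i = S i j by rewrite -[in LHS]Ssym mxE.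
  by move=> /le_trans; apply; rewrite le_eqVlt; apply/orP; left; apply/eqP; ring.
apply/eqP; apply/negPn/negP => Sij0.
(* For this t the lower bound S j j + 2 t S i j equals - 1. *)
have := h (- (S j j + 1) / (2 * S i j)).
have -> : 2 * (- (S j j + 1) / (2 * S i j)) * S i j = - (S j j + 1) by field.
by rewrite opprD addrA subrr add0r oppr_ge0 ler10.
Qed.

(** Symmetric elimination.  The list l contains the indices of the rows that may
    be nonzero.  If S i i = 0 the whole row i vanishes; otherwise subtracting b b^T,
    with b = S e_i / sqrt (S i i), clears row i and keeps the form positive
    semidefinite, because its value at a becomes the value of the old form at
    a - (form S a e_i / S i i) e_i. *)
Theorem psd_sum_of_squares S : S^T = S -> (forall a, 0 <= form S a a) ->
  exists s : seq 'cV[R]_n, forall a, form S a a = \sum_(b <- s) ((a^T *m b) 0 0) ^+ 2.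
Proof.
suff H (l : seq 'I_n) : forall S, S^T = S -> (forall a, 0 <= form S a a) ->
    (forall i, i \notin l -> forall j, S i j = 0) ->
    exists s : seq 'cV[R]_n, forall a, form S a a = \sum_(b <- s) ((a^T *m b) 0 0) ^+ 2.
  by move=> Ssym Spsd; apply: (H (enum 'I_n)) => // i; rewrite mem_enum.
elim: l => [|i l IH] {}S Ssym Spsd Sl.
  exists [::] => a; rewrite big_nil.
  have -> : S = 0 by apply/matrixP => i j; rewrite Sl// mxE.
  by rewrite /form mulmx0 mul0mx mxE.
have [Sii|Sii] := eqVneq (S i i) 0.
  apply: IH => // k kl j; have [->|ki] := eqVneq k i; first exact: psd_row0.
  by apply: Sl; rewrite inE negb_or ki.
have Sii_gt0 : 0 < S i i.
  by rewrite lt_neqAle eq_sym Sii -form_delta2 Spsd.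
pose b : 'cV[R]_n := (Num.sqrt (S i i))^-1 *: (S *m delta_mx i 0).
have bE a : (a^T *m b) 0 0 = (Num.sqrt (S i i))^-1 * form S a (delta_mx i 0).
  by rewrite /b -scalemxAr [LHS]mxE mulmxA.
have b2E a : ((a^T *m b) 0 0) ^+ 2 = form S a (delta_mx i 0) ^+ 2 / S i i.
  by rewrite bE exprMn exprVn sqr_sqrtr ?ltW// mulrC.
pose S' := S - b *m b^T.
have formS' a : form S' a a = form S a a - ((a^T *m b) 0 0) ^+ 2.
  rewrite /form /S' mulmxBr mulmxBl [LHS]mxE; congr (_ + _).
  rewrite [LHS]mxE; congr (- _); rewrite mulmxA -mulmxA [LHS]mxE big_ord1 expr2.
  congr (_ * _); have -> : b^T *m a = (a^T *m b)^T by rewrite trmx_mul trmxK.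
  by rewrite mxE.
have [||k kl j|s hs] := IH S'.
- by rewrite /S' linearB/= trmx_mul trmxK Ssym.
- move=> a; rewrite formS' b2E.
  set lam := form S a (delta_mx i 0) / S i i.
  have := Spsd (a + (- lam) *: delta_mx i 0).
  rewrite !formDl !formDr !formZl !formZr form_delta2.
  rewrite (formC (delta_mx i 0)  a Ssym).
  move=> /le_trans; apply; rewrite le_eqVlt; apply/orP; left; apply/eqP.
  by rewrite /lam; field.
- have bk m : b m 0 = (Num.sqrt (S i i))^-1 * S m i by rewrite mxE -colE mxE.
  rewrite /S' mxE [X in _ + X]mxE [X in _ - X]mxE big_ord1 [b^T _ _]mxE !bk.
  have [->|ki] := eqVneq k i; last first.
    by rewrite !(Sl k) ?inE ?negb_or ?ki// mulr0 mul0r subr0.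
  have -> : S j i = S i j by rewrite -[in LHS]Ssym mxE.
  rewrite mulrACA -expr2 exprVn sqr_sqrtr ?ltW// mulrA mulVf ?gt_eqF// mul1r.
  by rewrite subrr.
- exists (b :: s) => a; rewrite big_cons -hs formS'; ring.
Qed.

Lemma posdef_unitmx S : posdef S -> S \in unitmx.
Proof.
move=> [Ssym Spos]; rewrite unitmxE unitfE; apply/negP => /det0P[v v0 vS].
have := Spos v^T; rewrite trmxK vS mul0mx mxE ltxx => h.
by suff : false by []; apply: h; rewrite trmx_eq0.
Qed.

(** The form of the inverse at a is the form of S at S^-1 a. *)
Lemma posdef_inv_psd S a : posdef S -> 0 <= form (invmx S) a a.
Proof.
move=> Spd; have Su := posdef_unitmx Spd; case: Spd => Ssym Spos.
have [a0|a0] := eqVneq (invmx S *m a) 0.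
  by rewrite /form -mulmxA a0 mulmx0 mxE.
have := Spos _ a0.
rewrite trmx_mul trmx_inv Ssym -!mulmxA mulKVmx// => /ltW.
by rewrite /form mulmxA.
Qed.

End bilinear_form.

(** * Inverses of convergent matrices *)

Section matrix_limits.
Context (R : realType).

Lemma det_continuous n : continuous (fun A : 'M[R]_n => \det A).
Proof.
rewrite /determinant.
apply: continuous_sum => s.
suff cp (f : 'I_n -> 'I_n) : continuous (fun A : 'M[R]_n => \prod_i A i (f i)).
  by move=> A; exact: (cvgM (cvg_cst _) (cp _ A)).
apply: continuous_big => [|i _]; first exact: mul_continuous.
exact: coord_continuous.
Qed.

(** The cofactors are determinants of submatrices; with Cramer's formula
    this gives the continuity of the inverse. *)
Lemma adj_continuous n : continuous (fun A : 'M[R]_n => \adj A).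
Proof.
apply: continuous_mx => i j.
have -> : (fun A : 'M[R]_n => \adj A i j) =
    fun A => (-1) ^+ (j + i) * \det (row' j (col' i A)).
  by apply/funext => A; rewrite mxE.
suff cd : continuous (fun A : 'M[R]_n => \det (row' j (col' i A))).
  by move=> A; exact: (cvgM (cvg_cst _) (cd A)).
move=> A; apply: (@continuous_comp _ _ _ (fun A : 'M[R]_n => row' j (col' i A)) (fun A => \det A)).
  move: A; apply: continuous_mx => k l.
  have -> : (fun A : 'M[R]_n => row' j (col' i A) k l) = fun A => A (lift j k) (lift i l).
    by apply/funext => A; rewrite !mxE.
  exact: coord_continuous.
exact: det_continuous.
Qed.

Lemma cvg_near_unitmx n (F : nat -> 'M[R]_n) (A : 'M[R]_n) :
  A \in unitmx -> F K @[K --> \oo] --> A -> \forall K \near \oo, F K \in unitmx.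
Proof.
move=> Au FA.
have h : \det (F K) @[K --> \oo] --> \det A.
  exact: (@cvg_comp _ _ _ F (fun M : 'M[R]_n => \det M) \oo _ _ FA (@det_continuous n A)).
have d0 : \det A != 0 by rewrite -unitfE -unitmxE.
have : \forall x \near \det A, x != 0 by apply: (@open_neq _ (0 : R)).
by move=> /h; rewrite near_simpl => h'; near=> K; rewrite unitmxE unitfE; near: K.
Unshelve. all: by end_near.
Qed.

Lemma cvg_invmx n (F : nat -> 'M[R]_n) (A : 'M[R]_n) :
  A \in unitmx -> F K @[K --> \oo] --> A -> invmx (F K) @[K --> \oo] --> invmx A.
Proof.
move=> Au FA.
have h : \det (F K) @[K --> \oo] --> \det A.
  exact: (@cvg_comp _ _ _ F (fun M : 'M[R]_n => \det M) \oo _ _ FA (@det_continuous n A)).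
have h2 : \adj (F K) @[K --> \oo] --> \adj A.
  exact: (@cvg_comp _ _ _ F (fun M : 'M[R]_n => \adj M) \oo _ _ FA (@adj_continuous n A)).
have FKu := cvg_near_unitmx Au FA.
have d0 : \det A != 0 by rewrite -unitfE -unitmxE.
have -> : invmx A = (\det A)^-1 *: \adj A by rewrite /invmx Au.
apply: (@cvg_trans _ ((\det (F K))^-1 *: \adj (F K) @[K --> \oo])).
  apply: near_eq_cvg; near=> K.
  have Ku : F K \in unitmx by near: K; exact: FKu.
  by rewrite /invmx Ku.
apply: cvg_mx => i j; rewrite mxE.
under eq_cvg do rewrite mxE.
apply: cvgM; first exact: cvgV.
exact: cvg_mx_coord.
Unshelve. all: by end_near.
Qed.

Lemma cvg_mulmx m n q (F : nat -> 'M[R]_(m, n)) (G : nat -> 'M[R]_(n, q))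
    (A : 'M[R]_(m, n)) (B : 'M[R]_(n, q)) :
  F K @[K --> \oo] --> A -> G K @[K --> \oo] --> B ->
  F K *m G K @[K --> \oo] --> A *m B.
Proof.
move=> FA GB; apply: cvg_mx => i j; rewrite mxE.
under eq_cvg do rewrite mxE.
apply: cvg_big => [|k _]; first exact: add_continuous.
by apply: cvgM; exact: cvg_mx_coord.
Qed.

End matrix_limits.

(** * Vectorization and the normal equations *)

Section vectorization.
Context (R : realType) (N M : nat).
Implicit Types (A B c : 'M[R]_(N, M)).

Lemma vecE A i j : vec A (mxvec_index j i) 0 = A i j.
Proof. by rewrite /vec mxE mxvecE mxE. Qed.

Lemma vec_surj (x : 'cV[R]_(M * N)) : exists A : 'M[R]_(N, M), vec A = x.
Proof. by exists (vec_mx x^T)^T; rewrite /vec trmxK vec_mxK trmxK. Qed.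

(** Both vectorizations list the entries in the same order, so the Frobenius
    product is the dot product. *)
Lemma frobenius_vec A B : frobenius A B = ((vec B)^T *m vec A) 0 0.
Proof.
rewrite /frobenius mxE (reindex _ (curry_mxvec_bij M N))/=.
rewrite exchange_big/= pair_bigA/=; apply: eq_bigr => -[j i] _ /=.
by rewrite mxE !vecE mulrC.
Qed.

Lemma sqnorm2E n (x : 'cV[R]_n) : sqnorm2 x = (x^T *m x) 0 0.
Proof. by rewrite /sqnorm2 mxE; apply: eq_bigr => i _; rewrite mxE expr2. Qed.

Lemma sqnorm2_ge0 n (x : 'cV[R]_n) : 0 <= sqnorm2 x.
Proof. by apply: sumr_ge0 => i _; exact: sqr_ge0. Qed.

Lemma sqnorm2_eq0 n (x : 'cV[R]_n) : sqnorm2 x = 0 -> x = 0.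
Proof.
move=> /eqP; rewrite psumr_eq0; last by move=> i _; exact: sqr_ge0.
move=> /allP h; apply/matrixP => i j; rewrite ord1 mxE; apply/eqP.
by rewrite -sqrf_eq0; apply: h; rewrite mem_index_enum.
Qed.

(** Moving from the minimizer x along the direction g = D^T (z - D x) changes the
    squared residual by - 2 t |g|^2 + t^2 |D g|^2, which is negative for small t > 0
    unless g = 0. *)
Lemma normal_equations_of_min m n (D : 'M[R]_(m, n)) (z : 'cV[R]_m) (x : 'cV[R]_n) :
  (forall x', sqnorm2 (z - D *m x) <= sqnorm2 (z - D *m x')) ->
  D^T *m D *m x = D^T *m z.
Proof.
move=> xmin; set r := z - D *m x; pose g := D^T *m r.
suff g0 : g = 0.
  by apply/esym/eqP; rewrite -subr_eq0 -mulmxA -mulmxBr -/r -/g g0.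
apply: sqnorm2_eq0; set s := sqnorm2 g; set q := sqnorm2 (D *m g).
have s0 : 0 <= s := sqnorm2_ge0 g.
have q0 : 0 <= q := sqnorm2_ge0 (D *m g).
have h t : 0 <= - 2 * t * s + t ^+ 2 * q.
  have := xmin (x + t *: g).
  rewrite mulmxDr opprD addrA -/r -scalemxAr -subr_ge0.
  suff -> : sqnorm2 (r - t *: (D *m g)) = sqnorm2 r - 2 * t * s + t ^+ 2 * q.
    move=> /le_trans; apply; rewrite le_eqVlt; apply/orP; left; apply/eqP; ring.
  have -> : s = \sum_i r i 0 * (D *m g) i 0.
    rewrite /s sqnorm2E {1}/g trmx_mul trmxK -mulmxA mxE.
    by apply: eq_bigr => i _; rewrite mxE.
  rewrite /q /sqnorm2 !mulr_sumr -sumrB -big_split/=; apply: eq_bigr => i _.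
  by rewrite !mxE; ring.
apply/eqP; rewrite eq_le s0 andbT leNgt; apply/negP => sgt0.
(* A step small enough for the linear term to dominate; q + 1 avoids a
   division by 0. *)
have := h (s / (q + 1)).
have q1 : 0 < q + 1 by rewrite ltr_wpDl.
have -> : - 2 * (s / (q + 1)) * s + (s / (q + 1)) ^+ 2 * q =
   - (s ^+ 2 * (q + 2) / (q + 1) ^+ 2) by field; rewrite gt_eqF.
rewrite oppr_ge0 leNgt => /negP; apply.
by rewrite divr_gt0 ?mulr_gt0 ?exprn_gt0 ?ltr_wpDl.
Qed.

Lemma least_squares_normal (p : nat -> 'M[R]_(N, M)) (y : nat -> R) K c :
  least_squares p y K c ->
  (design p K)^T *m design p K *m vec c = (design p K)^T *m \col_(k < K) y k.
Proof.
move=> hc; apply: normal_equations_of_min => x'.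
by have [c' <-] := vec_surj x'; exact: hc.
Qed.

Lemma tr_design_mul (p : nat -> 'M[R]_(N, M)) K (z : 'cV[R]_K) :
  (design p K)^T *m z = \sum_(k < K) z k 0 *: vec (p k).
Proof.
apply/matrixP => i j; rewrite ord1 !mxE summxE; apply: eq_bigr => k _.
by rewrite !mxE mulrC.
Qed.

Lemma design_mulE (p : nat -> 'M[R]_(N, M)) K c :
  design p K *m vec c = \col_(k < K) frobenius c (p k).
Proof.
apply/matrixP => i j; rewrite ord1 [RHS]mxE frobenius_vec [LHS]mxE [RHS]mxE.
by apply: eq_bigr => l _; rewrite !mxE.
Qed.

End vectorization.

(** * Linear regression with fixed bounded regressors *)

Section noise.
Context d (T : measurableType d) (R : realType) (P : probability T R).

Lemma integral_sqr_centered (X : T -> R) (v : R) :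
  ('E_P[X] = 0)%E -> ('V_P[X] = v%:E)%E ->
  (\int[P]_w (X w ^+ 2)%:E = v%:E)%E.
Proof.
move=> EX0 <-; rewrite /variance covariance.unlock EX0/= expectation.unlock.
apply: eq_integral => w _.
by rewrite -[((X \- cst 0) * _) w]/((X w - 0) * (X w - 0)) subr0 expr2.
Qed.

(** E eps_i eps_j = E eps_i E eps_j = 0 by independence. *)
Lemma independent_centered_uncorrelated (eps : nat -> {RV P >-> R}) :
  independent_RVs eps -> (forall k, (eps k : T -> R) \in Lfun P 2%:E) ->
  (forall k, ('E_P[eps k] = 0)%E) ->
  forall i j, i != j -> (\int[P]_w (eps i w * eps j w)%:E = 0)%E.
Proof.
move=> ind L2 E0 i j ij.
have me k : measurable_fun setT (eps k) by exact: measurable_funPT.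
have i1 k : P.-integrable setT (EFin \o eps k).
  by apply/Lfun1_integrable; apply: Lfun_subset12 => //; rewrite fin_num_measure.
have iM : P.-integrable setT (EFin \o (eps i \* eps j)).
  exact/Lfun1_integrable/Lfun2_mul_Lfun1.
have := independent_pairM (me i) (me j) (independent_RVs_pair ind ij) (i1 i) (i1 j) iM.
have : \int[P]_w eps i w = 0.
  by have := E0 i; rewrite unlock /Rintegral => ->.
move=> ->; rewrite mul0r /Rintegral => h.
by rewrite -[LHS]fineK ?h//; exact: integrable_fin_num.
Qed.

End noise.

Section regression.
Context (R : realType) (n : nat) (x : nat -> 'cV[R]_n).

(** (1 / K) P_K^T P_K, where x k is the k-th row of the design matrix P_K, written as
    a column. *)
Definition gram K : 'M[R]_n := K%:R^-1 *: \sum_(k < K) x k *m (x k)^T.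

Lemma gram_sym K : (gram K)^T = gram K.
Proof.
rewrite /gram linearZ/= raddf_sum/=; congr (_ *: _); apply: eq_bigr => k _.
by rewrite trmx_mul trmxK.
Qed.

Lemma form_gram K a : form (gram K) a a = K%:R^-1 * \sum_(k < K) ((a^T *m x k) 0 0) ^+ 2.
Proof.
rewrite /form /gram -scalemxAr -scalemxAl mxE; congr (_ * _).
rewrite mulmx_sumr mulmx_suml summxE; apply: eq_bigr => k _.
rewrite -[_ *m a]mulmxA -[x k *m _ *m a]mulmxA mulmxA [LHS]mxE big_ord1 expr2.
congr (_ * _).
by rewrite -[in LHS](trmxK a) -trmx_mul mxE.
Qed.

Lemma dot_le_bounded (c z : 'cV[R]_n) (B : R) :
  (forall i, `|z i 0| <= B) -> `|(c^T *m z) 0 0| <= B * \sum_i `|c i 0|.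
Proof.
move=> zB; rewrite mxE (le_trans (ler_norm_sum _ _ _))// mulr_sumr ler_sum// => i _.
by rewrite mxE normrM mulrC ler_wpM2r.
Qed.

Context d (T : measurableType d) (P : probability T R).
Variables (eps : nat -> T -> R) (Q : 'M[R]_n) (B v : R).
Hypothesis x_le : forall k i, `|x k i 0| <= B.
Hypothesis Qu : Q \in unitmx.
Hypothesis gram_cvg : gram K @[K --> \oo] --> Q.
Hypothesis meps : forall k, measurable_fun setT (eps k).
Hypothesis eps2 : forall k, (\int[P]_w (eps k w ^+ 2)%:E = v%:E)%E.
Hypothesis epsM : forall i j, i != j -> (\int[P]_w (eps i w * eps j w)%:E = 0)%E.

Let v_ge0 : 0 <= v.
Proof.
by rewrite -lee_fin -(eps2 0); apply: integral_ge0 => w _; rewrite lee_fin sqr_ge0.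
Qed.

Let integral_sqr_scaled k (t : R) :
  (\int[P]_w ((eps k w * t) ^+ 2)%:E = (t ^+ 2 * v)%:E)%E.
Proof.
under eq_integral do rewrite exprMn mulrC EFinM.
rewrite ge0_integralZl//; last first.
- by rewrite lee_fin sqr_ge0.
- by move=> w _; rewrite lee_fin sqr_ge0.
- by apply/measurable_EFinP; exact: measurable_funX.
by rewrite eps2 EFinM.
Qed.

Let integral_mul_scaled i j (s t : R) : i != j ->
  (\int[P]_w ((eps i w * s) * (eps j w * t))%:E = 0)%E.
Proof.
move=> ij; under eq_integral do rewrite mulrACA mulrC EFinM.
have i2 k : P.-integrable setT (fun w => (eps k w ^+ 2)%:E).
  apply/integrableP; split; first by apply/measurable_EFinP; exact: measurable_funX.
  under eq_integral do rewrite gee0_abs ?lee_fin ?sqr_ge0//.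
  by rewrite eps2 ltry.
by rewrite integralZl ?epsM ?mule0//; exact: integrableM_L2.
Qed.

(** Each coordinate is a mean of the uncorrelated variables eps_k x_(k, i), whose
    second moments are at most B^2 v. *)
Lemma ae_cvg_score :
  {ae P, forall w, K%:R^-1 *: \sum_(k < K) eps k w *: x k @[K --> \oo] --> (0 : 'cV[R]_n)}.
Proof.
have H i : {ae P, forall w, K%:R^-1 * \sum_(0 <= k < K) (eps k w * x k i 0)
    @[K --> \oo] --> (0 : R)}.
  apply: (@slln_uncorrelated _ _ _ P (fun k w => eps k w * x k i 0) (B ^+ 2 * v)).
  - by move=> k; exact: measurable_funM.
  - move=> k; rewrite integral_sqr_scaled lee_fin ler_wpM2r//.
    by rewrite -[leLHS]real_normK ?num_real// lerXn2r ?nnegrE// (le_trans _ (x_le k i)).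
  - by move=> k l kl; exact: integral_mul_scaled.
have : {ae P, forall w, forall i, K%:R^-1 * \sum_(0 <= k < K) (eps k w * x k i 0)
    @[K --> \oo] --> (0 : R)} by exact: filter_forall.
apply: filterS => w Hw.
apply: cvg_mx => i j; rewrite ord1 [X in _ --> X]mxE.
have E K : (K%:R^-1 *: \sum_(k < K) eps k w *: x k) i 0 =
    K%:R^-1 * \sum_(0 <= k < K) (eps k w * x k i 0).
  by rewrite mxE summxE big_mkord; congr (_ * _); apply: eq_bigr => k _; rewrite mxE.
by under eq_cvg do rewrite E; exact: Hw.
Qed.

(** The normal equations express the estimation error as the inverse of the Gram
    matrix applied to the score, and the inverse converges to Q^-1 while the
    score vanishes almost surely. *)
Theorem least_squares_ae_cvg (err : nat -> T -> 'cV[R]_n) :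
  (forall K w, (0 < K)%N ->
     gram K *m err K w = K%:R^-1 *: \sum_(k < K) eps k w *: x k) ->
  {ae P, forall w, err K w @[K --> \oo] --> (0 : 'cV[R]_n)}.
Proof.
move=> errE; apply: filterS ae_cvg_score => w Hw.
have Gu := cvg_near_unitmx Qu gram_cvg.
have := cvg_mulmx (cvg_invmx Qu gram_cvg) Hw; rewrite mulmx0.
apply: cvg_trans; apply: near_eq_cvg; near=> K.
rewrite -errE ?mulKmx//; last by near: K; exact: nbhs_infty_gt.
by near: K; exact: Gu.
Unshelve. all: by end_near.
Qed.

(** The value of sqrt K times the estimation error whenever the Gram matrix is
    invertible.  Unlike the estimator it is a random vector for every K. *)
Definition normalized_score K w : 'cV[R]_n :=
  \sum_(k < K) eps k w *: ((Num.sqrt K%:R)^-1 *: (invmx (gram K) *m x k)).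

Lemma near_normalized_score (err : nat -> T -> 'cV[R]_n) :
  (forall K w, (0 < K)%N ->
     gram K *m err K w = K%:R^-1 *: \sum_(k < K) eps k w *: x k) ->
  \forall K \near \oo, forall w, Num.sqrt K%:R *: err K w = normalized_score K w.
Proof.
move=> errE; have Gu := cvg_near_unitmx Qu gram_cvg.
near=> K; move=> w.
have K0 : (0 < K)%N by near: K; exact: nbhs_infty_gt.
have KR : 0 < Num.sqrt (K%:R : R) by rewrite sqrtr_gt0 ltr0n.
have GK : gram K \in unitmx by near: K; exact: Gu.
rewrite -[err K w](mulKmx GK) errE// -scalemxAr scalerA.
have -> : Num.sqrt K%:R * K%:R^-1 = (Num.sqrt K%:R : R)^-1.
  by rewrite -{2}(sqr_sqrtr (ler0n R K)); field; rewrite gt_eqF.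
rewrite /normalized_score mulmx_sumr scaler_sumr; apply: eq_bigr => k _.
by rewrite -scalemxAr !scalerA mulrC.
Unshelve. all: by end_near.
Qed.

Definition score_weight (a : 'cV[R]_n) K k : R :=
  (Num.sqrt K%:R)^-1 * (a^T *m (invmx (gram K) *m x k)) 0 0.

Lemma dot_normalized_score a K w :
  (a^T *m normalized_score K w) 0 0 = \sum_(k < K) score_weight a K k * eps k w.
Proof.
rewrite /normalized_score mulmx_sumr summxE; apply: eq_bigr => k _.
by rewrite -!scalemxAr 2!mxE mulrC.
Qed.

Lemma measurable_normalized_score K i :
  measurable_fun setT (fun w => normalized_score K w i 0).
Proof.
have -> : (fun w => normalized_score K w i 0) =
    fun w => \sum_(k < K) score_weight (delta_mx i 0) K k * eps k w.
  apply/funext => w; rewrite -dot_normalized_score trmx_delta -rowE mxE.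
  by [].
by apply: measurable_sum => k; exact: measurable_funM.
Qed.

Lemma score_weight_le a : exists2 C, 0 <= C &
  \forall K \near \oo, forall k, `|score_weight a K k| <= C / Num.sqrt K%:R.
Proof.
pose c K := (invmx (gram K))^T *m a.
have cE K k : (a^T *m (invmx (gram K) *m x k)) 0 0 = ((c K)^T *m x k) 0 0.
  by rewrite /c trmx_mul trmxK mulmxA.
pose c0 := (invmx Q)^T *m a.
have cc i : c K i 0 @[K --> \oo] --> c0 i 0.
  apply: cvg_mx_coord; apply: cvg_mulmx; last exact: cvg_cst.
  apply: cvg_mx => k l; rewrite [X in _ --> X]mxE.
  under eq_cvg do rewrite mxE.
  by apply: cvg_mx_coord; exact: cvg_invmx.
have B0 : 0 <= B * (\sum_i `|c0 i 0| + 1) \/ forall K k, score_weight a K k = 0.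
  have [i _|no] := pickP 'I_n; [left|right].
    by rewrite mulr_ge0 ?addr_ge0 ?sumr_ge0// (le_trans _ (x_le 0 i)).
  move=> K k; rewrite /score_weight mxE big1 ?mulr0// => i.
  by have := no i.
have [{}B0|w0] := B0; last first.
  by exists 0 => //; apply: nearW => K k; rewrite w0 normr0 mul0r.
exists (B * (\sum_i `|c0 i 0| + 1)) => //.
have sc : \sum_i `|c K i 0| @[K --> \oo] --> \sum_i `|c0 i 0|.
  apply: cvg_big => [|i _]; first exact: add_continuous.
  exact: cvg_norm.
near=> K; move=> k.
have scK : \sum_i `|c K i 0| <= \sum_i `|c0 i 0| + 1.
  by near: K; apply: (cvgr_le _ sc); rewrite ltrDl.
rewrite /score_weight normrM ger0_norm ?invr_ge0 ?sqrtr_ge0// mulrC.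
rewrite ler_wpM2r ?invr_ge0 ?sqrtr_ge0// cE.
rewrite (le_trans (dot_le_bounded _ (x_le k)))//.
have [i _|no] := pickP 'I_n.
  by rewrite ler_wpM2l// (le_trans _ (x_le 0 i)).
rewrite big1 ?mulr0// => i; by have := no i.
Unshelve. all: by end_near.
Qed.

(** The sum of the squared weights is the form of the Gram matrix at G_K^-1 a, that is
    the form of G_K^-1 at a. *)
Lemma cvg_sum_sqr_score_weight a :
  \sum_(k < K) score_weight a K k ^+ 2 @[K --> \oo] --> form (invmx Q) a a.
Proof.
have Gu := cvg_near_unitmx Qu gram_cvg.
have : form (invmx (gram K)) a a @[K --> \oo] --> form (invmx Q) a a.
  apply: cvg_mx_coord; apply: cvg_mulmx; last exact: cvg_cst.
  by apply: cvg_mulmx; [exact: cvg_cst|exact: cvg_invmx].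
apply: cvg_trans; apply: near_eq_cvg; near=> K.
have GK : gram K \in unitmx by near: K; exact: Gu.
pose b := invmx (gram K) *m a.
have bT : b^T = a^T *m invmx (gram K) by rewrite trmx_mul trmx_inv gram_sym.
transitivity (form (gram K) b b).
  by rewrite /form bT -!mulmxA mulKVmx.
rewrite form_gram mulr_sumr; apply: eq_bigr => k _.
by rewrite /score_weight exprMn exprVn sqr_sqrtr ?ler0n// bT mulmxA.
Unshelve. all: by end_near.
Qed.

(** Chebyshev's inequality: the i-th coordinate is a sum of uncorrelated variables
    whose second moments are at most v (C i)^2 / K, so its own is at most v (C i)^2
    for large K. *)
Lemma normalized_score_tight (e : R) : 0 < e -> exists2 L, 0 < L &
  \forall K \near \oo, (P (outside_box (normalized_score K) L) <= e%:E)%E.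
Proof.
move=> e0.
have /choice[C hC] : forall i : 'I_n, exists C, 0 <= C /\
    \forall K \near \oo, forall k, `|score_weight (delta_mx i 0) K k| <= C / Num.sqrt K%:R.
  by move=> i; have [C C0 h] := score_weight_le (delta_mx i 0); exists C.
pose S := \sum_i C i ^+ 2 * v.
have S0 : 0 <= S by apply: sumr_ge0 => i _; rewrite mulr_ge0 ?sqr_ge0.
have L0 : 0 < Num.sqrt ((S + 1) / e) by rewrite sqrtr_gt0 divr_gt0// ltr_wpDl.
exists (Num.sqrt ((S + 1) / e)) => //; set L := Num.sqrt _ in L0 *.
have L2 : L ^+ 2 = (S + 1) / e.
  by rewrite sqr_sqrtr// ltW// divr_gt0// ltr_wpDl.
have hC' : \forall K \near \oo, forall i k,
    `|score_weight (delta_mx i 0) K k| <= C i / Num.sqrt K%:R.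
  by apply: filter_forall => i; exact: (hC i).2.
near=> K.
have K0 : (0 < K)%N by near: K; exact: nbhs_infty_gt.
have wK : forall i k, `|score_weight (delta_mx i 0) K k| <= C i / Num.sqrt K%:R by near: K.
have mV i := measurable_normalized_score K i.
have mV2 i : measurable_fun setT (fun w => ((normalized_score K w i 0) ^+ 2)%:E).
  by apply/measurable_EFinP; exact: measurable_funX.
have V2 i : (\int[P]_w ((normalized_score K w i 0) ^+ 2)%:E <= (C i ^+ 2 * v)%:E)%E.
  have -> : C i ^+ 2 * v = (C i / Num.sqrt K%:R) ^+ 2 * v * (K - 0)%:R.
    rewrite exprMn exprVn sqr_sqrtr ?ler0n// subn0; field.
    by rewrite pnatr_eq0 -lt0n.
  have := @integral_sqr_sum_uncorrelated _ _ _ P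
    (fun k w => eps k w * score_weight (delta_mx i 0) K k) ((C i / Num.sqrt K%:R) ^+ 2 * v) 0 K.
  have -> : (fun w => ((normalized_score K w i 0) ^+ 2)%:E) =
      (fun w => ((\sum_(0 <= k < K) eps k w * score_weight (delta_mx i 0) K k) ^+ 2)%:E).
    apply/funext => w; rewrite big_mkord; congr ((_ ^+ 2)%:E).
    under eq_bigr do rewrite mulrC.
    by rewrite -dot_normalized_score trmx_delta -rowE mxE.
  apply.
  - by move=> k; exact: measurable_funM.
  - move=> k; rewrite integral_sqr_scaled lee_fin ler_wpM2r//.
    rewrite -[leLHS]real_normK ?num_real// lerXn2r ?nnegrE//.
    exact: le_trans (wK i k).
  - by move=> k l kl; exact: integral_mul_scaled.
have mO := measurable_outside_box mV L.
have h : ((L ^+ 2)%:E * P (outside_box (normalized_score K) L) <= S%:E)%E.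
  rewrite -[outside_box _ _]setIT -integral_indic// -ge0_integralZl//; last first.
  - by rewrite lee_fin sqr_ge0.
  - exact/measurable_EFinP/measurable_indic.
  apply: (@le_trans _ _ (\int[P]_w (\sum_i ((normalized_score K w i 0) ^+ 2)%:E))%E).
    apply: ge0_le_integral => //.
    - by move=> w _; rewrite -EFinM lee_fin mulr_ge0 ?sqr_ge0.
    - by apply/measurable_EFinP; apply: measurable_funM => //; exact: measurable_indic.
    - exact: emeasurable_sum.
    - move=> w _; rewrite sumEFin -EFinM lee_fin indicE.
      have [|_] := boolP (w \in _); last first.
        by rewrite mulr0 sumr_ge0// => i _; exact: sqr_ge0.
      rewrite inE => -[i Li]; rewrite mulr1 (bigD1 i)//=.
      rewrite -[leLHS]addr0 lerD ?sumr_ge0//; last by move=> j _; exact: sqr_ge0.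
      by rewrite -[leRHS]real_normK ?num_real// lerXn2r ?nnegrE ?(ltW L0)// ltW.
  rewrite ge0_integral_sum//; last by move=> i w _; rewrite lee_fin sqr_ge0.
  by rewrite /S -sumEFin; apply: lee_sum.
move: h; rewrite -(@fineK _ (P _)) ?fin_num_measure//; move: (fine _) => q.
rewrite -EFinM !lee_fin L2 mulrAC ler_pdivrMr// => h.
have S1 : 0 < S + 1 by rewrite ltr_wpDl.
rewrite -(ler_pM2l S1) (le_trans h)// ler_wpM2r ?(ltW e0)//.
by rewrite lerDl.
Unshelve. all: by end_near.
Qed.

End regression.

(** The error multiplied by sqrt K is eventually the normalized score, which is tight and
    whose linear functionals satisfy Lindeberg's theorem with limit variance
    v a^T Q^-1 a.  Writing this quadratic form as a sum of squares provides the Gaussian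
    limit, and Levy's theorem concludes. *)
Theorem least_squares_asymptotically_normal (R : realType) n
    d (T : measurableType d) (P : probability T R)
    (x : nat -> 'cV[R]_n) (eps : nat -> {RV P >-> R}) (Q : 'M[R]_n)
    (B v delta b : R) (err : nat -> T -> 'cV[R]_n) :
  (forall k i, `|x k i 0| <= B) -> posdef Q -> gram x K @[K --> \oo] --> Q ->
  independent_RVs eps -> (forall k, (eps k : T -> R) \in Lfun P 2%:E) ->
  (forall k, ('E_P[eps k] = 0)%E) -> (forall k, ('V_P[eps k] = v%:E)%E) ->
  0 < delta ->
  (forall k, ('E_P[(fun w => `|eps k w| `^ (2 + delta))%R] <= b%:E)%E) ->
  (forall K w, (0 < K)%N ->
     gram x K *m err K w = K%:R^-1 *: \sum_(k < K) eps k w *: x k) ->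
  exists2 mu : probability (borel 'cV[R]_n) R,
    is_multinormal 0 (v *: invmx Q) mu &
    cvg_in_distribution P (fun K w => Num.sqrt K%:R *: err K w) mu.
Proof.
move=> xB Qpd GQ ind L2 E0 Ev d0 mom errE.
have Qu := posdef_unitmx Qpd.
have me k : measurable_fun setT (eps k) by exact: measurable_funPT.
have e2 k := integral_sqr_centered (E0 k) (Ev k).
have v0 : 0 <= v.
  by rewrite -lee_fin -(e2 0); apply: integral_ge0 => w _; rewrite lee_fin sqr_ge0.
have ie k : P.-integrable setT (EFin \o eps k).
  by apply/Lfun1_integrable; apply: Lfun_subset12 => //; rewrite fin_num_measure.
have ie2 k : P.-integrable setT (fun w => (eps k w ^+ 2)%:E).
  exact: Lfun2_integrable_sqr.
have eM := independent_centered_uncorrelated ind L2 E0.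
pose V := normalized_score x eps.
have Verr := @near_normalized_score R n x d T (fun k => eps k : T -> R) Q Qu GQ err errE.
have mV K i : measurable_fun setT (fun w => V K w i 0).
  exact: measurable_normalized_score.
have formS a : form (v *: invmx Q) a a = v * form (invmx Q) a a.
  by rewrite /form -scalemxAr -scalemxAl mxE.
have Ssym : (v *: invmx Q)^T = v *: invmx Q.
  by rewrite linearZ/= trmx_inv Qpd.1.
have Spsd a : 0 <= form (v *: invmx Q) a a.
  by rewrite formS mulr_ge0// posdef_inv_psd.
have [s hs] := psd_sum_of_squares Ssym Spsd.
have [mu hmu] := gaussian_vector_exists s.
exists mu.
  by apply: multinormal_of_charfun => // a theta; rewrite hmu -hs.
split.
  near=> K.
  have -> : (fun w => Num.sqrt K%:R *: err K w) = V K.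
    by apply/funext => w; have h : forall w, Num.sqrt K%:R *: err K w = V K w by near: K.
  exact: measurable_fun_borel_cV.
move=> f cf [c fc].
have lim : \int[P]_w f (V K w) @[K --> \oo] --> \int[mu]_z f (z : 'cV[R]_n).
  apply: (@levy_continuity R n _ _ P V _ _ mu (fun z : borel 'cV[R]_n => (z : 'cV[R]_n))) => //.
  - by move=> i; apply: continuous_measurable_borel; exact: coord_continuous.
  - move=> a theta; rewrite hmu -hs formS.
    have [C C0 wC] := score_weight_le xB Qu GQ a.
    have -> : v * form (invmx Q) a a / 2 = v / 2 * form (invmx Q) a a by rewrite mulrAC.
    have EY k : \int[P]_w eps k w = 0.
      by have := E0 k; rewrite unlock /Rintegral => ->.
    have EY2 k : \int[P]_w (eps k w ^+ 2) = v by rewrite /Rintegral e2.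
    have wC' : \forall K \near \oo, forall k, (k < K)%N ->
        `|score_weight x a K k| <= C / Num.sqrt K%:R.
      by apply: filterS wC => K wK k _.
    have -> : (fun K => \int[P]_w cos (theta + (a^T *m V K w) 0 0)) =
        (fun K => \int[P]_w cos (theta + \sum_(k < K) score_weight x a K k * eps k w)).
      by apply/funext => K; apply: eq_Rintegral => w _; rewrite dot_normalized_score.
    have UI := uniform_integrability_moment me d0 mom.
    have sw := @cvg_sum_sqr_score_weight _ _ _ _ Qu GQ a.
    exact: (cvg_charfun_triangular ind ie ie2 EY EY2 UI v0 C0 wC' sw).
  - by move=> e e0; exact: (normalized_score_tight xB Qu GQ me e2 eM e0).
  - by exists c.
have mf : measurable_fun setT (f : borel 'cV[R]_n -> R) by exact: continuous_measurable_borel.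
have -> : (\int[mu]_z (f z)%:E = (\int[mu]_z f (z : 'cV[R]_n))%:E)%E.
  rewrite /Rintegral fineK//; apply: integrable_fin_num => //.
  exact: (@integrable_bounded _ _ _ mu f c).
have limE : ((\int[P]_w f (V K w))%:E @[K --> \oo] --> (\int[mu]_z f (z : 'cV[R]_n))%:E)%E.
  by apply: cvg_EFin => //; exact: nearW.
apply: cvg_trans limE.
apply: near_eq_cvg; near=> K.
have h : forall w, Num.sqrt K%:R *: err K w = V K w by near: K.
rewrite /= /Rintegral expectation.unlock fineK; last first.
  apply: integrable_fin_num => //.
  apply: (@integrable_bounded _ _ _ P _ c) => //.
  exact: (measurableT_comp mf (measurable_fun_borel_cV (mV K))).
by apply: eq_integral => w _; rewrite /= h.
Unshelve. all: by end_near.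
Qed.

(** * Regression on transport plans *)

(** An entry of a plan is at most its row sum, a coordinate of a point of the
    simplex; this bounds the regressors. *)
Lemma transport_plan_le1 (R : realType) N M (mu : 'cV[R]_N) (nu : 'cV[R]_M)
    (p : 'M[R]_(N, M)) :
  prob_simplex mu -> transport_plans mu nu p -> forall l, `|vec p l 0| <= 1.
Proof.
move=> [mu0 mu1] [p0 pmu _] l; case/mxvec_indexP: l => j i.
rewrite vecE ger0_norm//; apply: (@le_trans _ _ (mu i 0)).
  by rewrite -pmu (bigD1 j)//= lerDl sumr_ge0.
by rewrite -mu1 (bigD1 i)//= lerDl sumr_ge0.
Qed.

Lemma gram_design (R : realType) N M (p : nat -> 'M[R]_(N, M)) K :
  K%:R^-1 *: ((design p K)^T *m design p K) = gram (fun k => vec (p k)) K.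
Proof.
congr (_ *: _); apply/matrixP => i j; rewrite summxE mxE; apply: eq_bigr => k _.
by rewrite [RHS]mxE big_ord1 !mxE.
Qed.

(** Subtract from the normal equations of the estimator the identity
    P_K^T P_K c = P_K^T (y - e). *)
Lemma least_squares_error (R : realType) N M (p : nat -> 'M[R]_(N, M))
    (c chat : 'M[R]_(N, M)) (y e : nat -> R) K :
  (forall k, y k = frobenius c (p k) + e k) -> least_squares p y K chat ->
  gram (fun k => vec (p k)) K *m (vec chat - vec c) =
  K%:R^-1 *: \sum_(k < K) e k *: vec (p k).
Proof.
move=> yE /least_squares_normal normal; rewrite -gram_design -scalemxAl mulmxBr normal.
have -> : \col_(k < K) y k = design p K *m vec c + \col_(k < K) e k.
  by apply/matrixP => k j; rewrite design_mulE !mxE.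
rewrite mulmxDr mulmxA addrAC subrr add0r tr_design_mul; congr (_ *: _).
by apply: eq_bigr => k _; rewrite mxE.
Qed.

Theorem theorem3p1 (R : realType) (N M : nat)
  (mu : nat -> 'cV[R]_N) (nu : nat -> 'cV[R]_M)
  (p : nat -> 'M[R]_(N, M)) (alpha : nat -> R) (c : 'M[R]_(N, M))
  (mu_simplex : forall k, prob_simplex (mu k))
  (nu_simplex : forall k, prob_simplex (nu k))
  (p_plan : forall k, transport_plans (mu k) (nu k) (p k))
  (alpha_ot : forall k, alpha k = ot_cost c (mu k) (nu k))
  (alpha_p : forall k, alpha k = frobenius c (p k))
  (d : measure_display) (T : measurableType d) (P : probability T R)
  (eps : nat -> {RV P >-> R}) (sigma : R)
  (sigma2_gt0 : 0 < sigma ^+ 2)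
  (eps_indep : independent_RVs eps)
  (eps_L2 : forall k, (eps k : T -> R) \in Lfun P 2%:E)
  (eps_centered : forall k, ('E_P[eps k] = 0)%E)
  (eps_var : forall k, ('V_P[eps k] = (sigma ^+ 2)%:E)%E)
  (y : nat -> T -> R)
  (y_def : forall k w, y k w = alpha k + eps k w)
  (Q : 'M[R]_(M * N)) (Q_posdef : posdef Q)
  (design_cvg :
    K%:R^-1 *: ((design p K)^T *m design p K) @[K --> \oo] --> Q)
  (chat : nat -> T -> 'M[R]_(N, M))
  (chat_ls : forall K w, (0 < K)%N ->
    least_squares p (fun k => y k w) K (chat K w)) :
  {ae P, forall w, vec (chat K w) @[K --> \oo] --> vec c} /\
  ((exists2 delta : R, 0 < delta &
      exists b : R, forall k,
        ('E_P[(fun w => `|eps k w| `^ (2 + delta))%R] <= b%:E)%E) ->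
   exists2 normal : probability (borel 'cV[R]_(M * N)) R,
     is_multinormal 0 (sigma ^+ 2 *: invmx Q) normal &
     cvg_in_distribution P
       (fun K w => Num.sqrt K%:R *: (vec (chat K w) - vec c)) normal).
Proof.
pose x k := vec (p k).
have xB k l : `|x k l 0| <= 1 by exact: transport_plan_le1 (mu_simplex k) (p_plan k) l.
have GQ : gram x K @[K --> \oo] --> Q.
  by under eq_cvg do rewrite -gram_design.
have errE K w : (0 < K)%N -> gram x K *m (vec (chat K w) - vec c) =
    K%:R^-1 *: \sum_(k < K) eps k w *: x k.
  move=> K0; apply: (@least_squares_error R N M p c _ (y^~ w) (fun k => eps k w)).
    by move=> k; rewrite y_def alpha_p.
  exact: chat_ls.
split.
  have me k : measurable_fun setT (eps k) by exact: measurable_funPT.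
  have e2 k := integral_sqr_centered (eps_centered k) (eps_var k).
  have eM := independent_centered_uncorrelated eps_indep eps_L2 eps_centered.
  have := least_squares_ae_cvg xB (posdef_unitmx Q_posdef) GQ me e2 eM errE.
  apply: filterS => w; rewrite -[X in _ -> _ --> X]add0r => /cvgD/(_ (cvg_cst (vec c))).
  by under eq_cvg do rewrite subrK.
move=> [delta d0 [b mom]].
exact: (least_squares_asymptotically_normal xB Q_posdef GQ eps_indep eps_L2
  eps_centered eps_var d0 mom errE).
Qed.
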